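(* There is an algorithm which, given a non-negative integer $m\times n$ matrix $A$ and a vector $b=(b_1,\dots,b_m)$, together with a path decomposition of width $k$ of the column matroid of $A$, decides (IP) for $(A,b)$ in time $O((d+1)^{k+1}mn+m^2n)$, where $d=\max\{b_1,\ldots,b_m\}$.
   Context: (IP) is the decision problem: given an integer $m\times n$ matrix $A$ and an integer vector $b\in\mathbb{Z}^m$, decide whether there exists $x\in\mathbb{Z}_{\ge0}^n$ with $Ax=b$. The column matroid $M(A)$ of $A$ has as ground set $U$ the columns of $A$ (indexed by $[n]$), a set being independent iff the corresponding columns are linearly independent; $r$ denotes its rank function. The connectivity function is $\lambda(X)=r(X)+r(U\setminus X)-r(U)+1$ for $X\subseteq U$ (equivalently, $\lambda(X)-1$ is the dimension of $\mathrm{span}(\text{columns in }X)\cap\mathrm{span}(\text{columns not in }X)$). A branch decomposition of $M(A)$ is a cubic tree $T$ (all internal vertices of degree 3) together with a bijection-like map $\mu$ sending the elements of $U$ to leaves of $T$; each edge $e$ of $T$ splits the leaves into two sides, inducing a partition $(X_e, U\setminus X_e)$, and the width of $e$ is $\lambda(X_e)$; the width of the decomposition is the maximum width of its edges. A path decomposition is a branch decomposition in which $T$ is a cubic caterpillar (a tree obtained from a path by attaching leaves to path vertices); the path-width of $M(A)$ is the minimum width of a path decomposition. *)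

(* Defs.v *)
From HB Require Import structures.
From mathcomp Require Import all_boot all_order all_algebra.

Set Implicit Arguments.
Unset Strict Implicit.
Unset Printing Implicit Defensive.

Import Order.TTheory GRing.Theory Num.Theory.
Local Open Scope ring_scope.

(** * Integer programming feasibility *)

Definition ip_feasible (m n : nat) (A : 'M[int]_(m, n)) (b : 'cV[int]_m) : Prop :=
  exists x : 'cV[int]_n, (forall j, 0 <= x j ord0) /\ A *m x = b.

(* Maximum entry of [b].  The maximum is taken together with 0, which only
   matters when every entry of [b] is negative. *)
Definition max_entry (m : nat) (b : 'cV[int]_m) : nat :=
  absz (\big[Num.max/0]_(i < m) b i ord0).

(** * The column matroid and its connectivity function *)

Definition col_indep (m n : nat) (A : 'M[int]_(m, n)) (X : {set 'I_n}) : bool :=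
  free [seq col j (map_mx intr A : 'M[rat]_(m, n)) | j <- enum X].

Definition col_rank (m n : nat) (A : 'M[int]_(m, n)) (X : {set 'I_n}) : nat :=
  \max_(Y : {set 'I_n} | (Y \subset X) && col_indep A Y) #|Y|.

(* The truncated subtraction is harmless, the rank being subadditive. *)
Definition connectivity (m n : nat) (A : 'M[int]_(m, n)) (X : {set 'I_n}) : nat :=
  (col_rank A X + col_rank A (~: X) - col_rank A [set: 'I_n] + 1)%N.

(** * Path decompositions *)

(* A finite graph given by its list of edges, each edge being listed once, in
   either orientation, together with a map from [n] elements to vertices. *)
Record labelled_graph (n : nat) := LabelledGraph {
  n_vertices : nat;
  edges : seq ('I_n_vertices * 'I_n_vertices);
  label : 'I_n -> 'I_n_vertices
}.

Section Decompositions.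
Variables (n : nat) (D : labelled_graph n).
Local Notation vertex := 'I_(n_vertices D).

Definition adj : rel vertex :=
  fun u v => ((u, v) \in edges D) || ((v, u) \in edges D).

(* The second conjunct also rules out loops. *)
Definition simple_edges : Prop :=
  uniq (edges D) /\ (forall u v, (u, v) \in edges D -> (v, u) \notin edges D).

Definition degree (v : vertex) : nat := #|[set u | adj v u]|.

(* Degree 0 only occurs for the one-vertex tree, whose vertex counts as a
   leaf. *)
Definition is_leaf (v : vertex) : bool := (degree v <= 1)%N.

(* Closed walks of size 2 without repeated vertices go back and forth along
   an edge; the longer ones are the cycles of the graph. *)
Definition is_tree : Prop :=
  [/\ (0 < n_vertices D)%N,
      forall u v : vertex, connect adj u v
    & forall c : seq vertex, ucycle adj c -> (size c <= 2)%N].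

Definition is_cubic : Prop :=
  forall v : vertex, ~~ is_leaf v -> degree v = 3.

(* [x :: p] is the path to which all the other vertices are attached. *)
Definition is_caterpillar : Prop :=
  is_tree /\
  exists (x : vertex) (p : seq vertex),
    [/\ path adj x p, uniq (x :: p)
      & forall v, v \notin x :: p ->
          degree v = 1%N /\ exists2 u, u \in x :: p & adj u v].

Definition labels_leaves : Prop :=
  injective (label D) /\ (forall v, (v \in codom (label D)) = is_leaf v).

Definition is_path_decomposition : Prop :=
  [/\ simple_edges, is_caterpillar, is_cubic & labels_leaves].

Definition adj_without (e : vertex * vertex) : rel vertex :=
  fun x y => [&& adj x y, (x, y) != e & (y, x) != e].

(* The elements on the side of [e.1] once the edge [e] is removed. *)
Definition displayed (e : vertex * vertex) : {set 'I_n} :=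
  [set i | connect (adj_without e) e.1 (label D i)].

(* The width is 0 if there is no edge, that is, if there is one element. *)
Definition width (m : nat) (A : 'M[int]_(m, n)) : nat :=
  \max_(e <- edges D) connectivity A (displayed e).

End Decompositions.

(** * The machine model

   Random access machine with unit-cost arithmetic, programmed in a structured
   language.  Storage consists of scalar variables and of unbounded
   one-dimensional arrays; each cell holds a rational number.  The operations
   are those of an ordered field: rounding or bitwise operations at unit cost on
   unbounded numbers would make the machine unreasonably powerful.  For the same
   reason, using as an array index a value that is not a natural number is a
   fault rather than being rounded: the execution then has no outcome. *)

Inductive expr :=
| Const of int
| Var of nat
| Get of nat & expr
| Add of expr & expr
| Sub of expr & expr
| Mul of expr & expr
| Div of expr & expr.

Inductive test :=
| Leq of expr & expr
| Not of test
| And of test & test.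

Inductive cmd :=
| Skip
| Assign of nat & expr
| Store of nat & expr & expr
| Seq of cmd & cmd
| If of test & cmd & cmd
| While of test & cmd.

Record state := State { var : nat -> rat; arr : nat -> nat -> rat }.

Definition set_var (s : state) (x : nat) (v : rat) : state :=
  State (fun y => if y == x then v else var s y) (arr s).

Definition set_arr (s : state) (a p : nat) (v : rat) : state :=
  State (var s)
    (fun a' p' => if (a' == a) && (p' == p) then v else arr s a' p').

Definition address (q : rat) : option nat :=
  if q \is a Num.nat then Some (Num.truncn q) else None.

Definition lift2 (T : Type) (f : rat -> rat -> T) (x y : option rat) : option T :=
  if x is Some u then if y is Some v then Some (f u v) else None else None.

(* [x / 0 = 0], as everywhere in the library. *)
Fixpoint eval (s : state) (e : expr) : option rat :=
  match e with
  | Const z => Some z%:~R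
  | Var x => Some (var s x)
  | Get a e1 => omap (arr s a) (obind address (eval s e1))
  | Add e1 e2 => lift2 (fun u v => u + v) (eval s e1) (eval s e2)
  | Sub e1 e2 => lift2 (fun u v => u - v) (eval s e1) (eval s e2)
  | Mul e1 e2 => lift2 (fun u v => u * v) (eval s e1) (eval s e2)
  | Div e1 e2 => lift2 (fun u v => u / v) (eval s e1) (eval s e2)
  end.

Fixpoint eval_test (s : state) (t : test) : option bool :=
  match t with
  | Leq e1 e2 => lift2 (fun u v => u <= v) (eval s e1) (eval s e2)
  | Not t1 => omap negb (eval_test s t1)
  | And t1 t2 =>
      if eval_test s t1 is Some b1 then
        if eval_test s t2 is Some b2 then Some (b1 && b2) else None
      else None
  end.

(* Every node of an expression or of a test costs one time unit each time the
   expression or the test is evaluated. *)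
Fixpoint expr_cost (e : expr) : nat :=
  match e with
  | Const _ | Var _ => 1
  | Get _ e1 => (expr_cost e1).+1
  | Add e1 e2 | Sub e1 e2 | Mul e1 e2 | Div e1 e2 =>
      (expr_cost e1 + expr_cost e2).+1
  end%N.

Fixpoint test_cost (t : test) : nat :=
  match t with
  | Leq e1 e2 => (expr_cost e1 + expr_cost e2).+1
  | Not t1 => (test_cost t1).+1
  | And t1 t2 => (test_cost t1 + test_cost t2).+1
  end%N.

(* [exec c s s' t]: started in [s], the program [c] halts in [s'] after [t]
   time units. *)
Inductive exec : cmd -> state -> state -> nat -> Prop :=
| ExecSkip s : exec Skip s s 1
| ExecAssign x e s v of eval s e = Some v :
    exec (Assign x e) s (set_var s x v) (expr_cost e).+1
| ExecStore a e1 e2 s q p v of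
    eval s e1 = Some q & address q = Some p & eval s e2 = Some v :
    exec (Store a e1 e2) s (set_arr s a p v) (expr_cost e1 + expr_cost e2).+1
| ExecSeq c1 c2 s s1 s2 t1 t2 of exec c1 s s1 t1 & exec c2 s1 s2 t2 :
    exec (Seq c1 c2) s s2 (t1 + t2)
| ExecIfTrue b c1 c2 s s' t of eval_test s b = Some true & exec c1 s s' t :
    exec (If b c1 c2) s s' (test_cost b + t).+1
| ExecIfFalse b c1 c2 s s' t of eval_test s b = Some false & exec c2 s s' t :
    exec (If b c1 c2) s s' (test_cost b + t).+1
| ExecWhileTrue b c s s1 s2 t1 t2 of eval_test s b = Some true
    & exec c s s1 t1 & exec (While b c) s1 s2 t2 :
    exec (While b c) s s2 (test_cost b + t1 + t2).+1
| ExecWhileFalse b c s of eval_test s b = Some false :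
    exec (While b c) s s (test_cost b).+1.

(** * Input and output conventions *)

(* Variables 0 to 3 hold the number of rows, of columns, of vertices and of
   edges.  Arrays 0 to 3 hold [A] in row-major order, [b], the endpoints of
   the edges (two consecutive cells for each edge) and the leaf of each column.
   All other cells hold 0. *)
Definition input (m n : nat) (A : 'M[int]_(m, n)) (b : 'cV[int]_m)
    (D : labelled_graph n) : state :=
  let scalars : seq rat :=
    [:: m%:R; n%:R; (n_vertices D)%:R; (size (edges D))%:R] in
  let arrays : seq (seq rat) :=
    [:: [seq (A i j)%:~R | i <- enum 'I_m, j <- enum 'I_n];
        [seq (b i ord0)%:~R | i <- enum 'I_m];
        flatten [seq [:: (nat_of_ord e.1)%:R; (nat_of_ord e.2)%:R] | e <- edges D];
        [seq (nat_of_ord (label D j))%:R | j <- enum 'I_n]] in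
  State (fun x => nth 0 scalars x) (fun a p => nth 0 (nth [::] arrays a) p).

(* The answer to a decision problem is left in variable 0. *)
Definition answers (s : state) (Q : Prop) : Prop :=
  (Q /\ var s 0 = 1) \/ (~ Q /\ var s 0 = 0).

(* Main.v *)
(** Sweep the columns in the order in which the caterpillar meets them.  After
    [k] columns keep the set [L_k] of the partial sums [y <= b] for which [b - y]
    is not excluded from the span of the remaining columns.  Two elements of
    [L_k] differ by a vector lying both in the span of the first columns and in
    that of the remaining ones, a space whose dimension is the connectivity minus
    one.  A set of vectors with entries in [{0..d}] whose differences span a space
    of dimension [r] has at most [(d+1)^r] elements, so [L_k] has at most
    [(d+1)^width] elements, each with [d+1] candidate successors of length [m].

    Membership of [b - y] in the span of the remaining columns takes a single
    linear test per candidate: let [P] be the orthogonal projection onto the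
    complement of that span; adding a column [c] to it makes [P] lose the direction
    [P c], so [y] is tested against [f = P c] only.  All these [f] come from one
    backward sweep of rank-one updates, in time [m^2] per column. *)

Require Import Defs.
From mathcomp Require Import all_boot all_order all_algebra zify ring.

Set Implicit Arguments.
Unset Strict Implicit.
Unset Printing Implicit Defensive.

Import Order.TTheory GRing.Theory Num.Theory.
Local Open Scope ring_scope.

(** * Column spaces and connectivity *)

(** The obstacle is that the width controls only the sets displayed by tree edges, while the sweep
    takes the columns one at a time. In a cubic caterpillar at most three leaves hang from the same
    internal vertex. Hence every prefix of the order differs by at most one column from a set
    displayed by an edge of the path, or from the empty or the full set, and one column changes the
    dimension of the common span by at most one. Connectivity is that dimension plus one, so this
    unit pays for the extra column, and the exponent of the layer bound is the width itself.

    To make prefixes easy to address, each position on the path owns three slots. A slot without a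
    column holds the zero column, which is harmless for feasibility and for all spans; the number of
    slots remains linear in [n].

    The vector [b] may lie outside the column space. The size bound therefore speaks only of
    differences of members of a layer: two vectors that pass the same linear test have a difference
    in its kernel. *)

Section ColumnSpaces.
Variables (m n : nat) (A : 'M[int]_(m, n)).

Definition rat_col (j : 'I_n) : 'cV[rat]_m := col j (map_mx intr A).

Definition col_space (X : {set 'I_n}) : {vspace 'cV[rat]_m} :=
  (\sum_(j in X) <[rat_col j]>)%VS.

Lemma col_spaceE X : col_space X = <<[seq rat_col j | j <- enum X]>>%VS.
Proof. by rewrite span_def big_map big_enum. Qed.

Lemma rat_col_in (X : {set _}) j : j \in X -> rat_col j \in col_space X.
Proof.
move=> jX; rewrite col_spaceE; apply/memv_span/map_f.
by rewrite mem_enum.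
Qed.

Lemma col_space_sub (X : {set 'I_n}) (V : {vspace _}) :
  (forall j, j \in X -> rat_col j \in V) -> (col_space X <= V)%VS.
Proof. by move=> h; apply/subv_sumP => j jX; rewrite -memvE h. Qed.

Lemma col_spaceS (X Y : {set 'I_n}) :
  X \subset Y -> (col_space X <= col_space Y)%VS.
Proof.
by move=> sXY; apply: col_space_sub => j /(subsetP sXY); exact: rat_col_in.
Qed.

(** A maximal independent subset of [X] spans [col_space X], because any column outside its span
    could be added to it. *)
Lemma col_rankE X : col_rank A X = \dim (col_space X).
Proof.
apply/eqP; rewrite eqn_leq; apply/andP; split.
  apply/bigmax_leqP => Y /andP[sYX]; rewrite /col_indep.
  rewrite -/(map rat_col _) /free -col_spaceE size_map -cardE => /eqP <-.
  exact: dimvS (col_spaceS sYX).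
pose p (Y : {set 'I_n}) := (Y \subset X) && col_indep A Y.
have [|Y /maxsetP[/andP[sYX fY] maxY] _] := @maxset_exists _ p set0.
  by rewrite /p sub0set /col_indep enum_set0 /= nil_free.
have sXY : (col_space X <= col_space Y)%VS.
  apply: col_space_sub => j jX; case: (boolP (rat_col j \in _)) => // jNY.
  have jY : j \notin Y by apply: contra jNY; exact: rat_col_in.
  suff /maxY/(_ (subsetUr _ _)) eYj : p (j |: Y).
    by rewrite -eYj setU11 in jY.
  rewrite /p subUset sub1set jX sYX /= /col_indep.
  have /perm_free -> : perm_eq
      [seq rat_col j | j <- enum (j |: Y)] (rat_col j :: [seq rat_col j | j <- enum Y]).
    rewrite -[_ :: _]/(map rat_col (j :: enum Y)); apply: perm_map.
    apply: uniq_perm; rewrite /= ?enum_uniq ?mem_enum ?jY // => i.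
    by rewrite !(inE, mem_enum).
  by rewrite free_cons -col_spaceE jNY.
apply: leq_trans (dimvS sXY) _.
move: (fY); rewrite /col_indep -/(map rat_col _) /free -col_spaceE size_map -cardE.
by move=> /eqP ->; apply: (@leq_bigmax_cond _ p (fun Y => #|Y|)); rewrite /p sYX.
Qed.

Definition meet_dim (X : {set 'I_n}) : nat :=
  \dim (col_space X :&: col_space (~: X)).

Lemma col_space_setT X : (col_space X + col_space (~: X))%VS = col_space setT.
Proof.
rewrite /col_space [RHS](bigID (mem X)) /=; congr (_ + _)%VS;
  by apply: eq_bigl => j; rewrite !inE.
Qed.

Lemma meet_dim_rank X :
  (\dim (col_space setT) + meet_dim X =
   \dim (col_space X) + \dim (col_space (~: X)))%N.
Proof. by rewrite /meet_dim -(col_space_setT X) dimv_sum_cap. Qed.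

Lemma connectivityE X : connectivity A X = (meet_dim X).+1.
Proof. by rewrite /connectivity !col_rankE -meet_dim_rank addKn addn1. Qed.

Lemma meet_dimC X : meet_dim (~: X) = meet_dim X.
Proof. by rewrite /meet_dim setCK capvC. Qed.

Lemma meet_dim0 : meet_dim set0 = 0%N.
Proof. by rewrite /meet_dim /col_space big_set0 cap0v dimv0. Qed.

Lemma dim_col_space_near (X Y : {set 'I_n}) : (#|Y :\: X| <= 1)%N ->
  (\dim (col_space Y) <= (\dim (col_space X)).+1)%N.
Proof.
move=> le1; have [j sj] : exists v, (\dim <[v : 'cV[rat]_m]> <= 1)%N /\
    (forall i, i \in Y :\: X -> rat_col i \in <[v]>%VS).
  have [|] := posnP #|Y :\: X|.
    move/cards0_eq => ->; exists 0; split=> [|i]; last by rewrite inE.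
    by rewrite dim_vline eqxx.
  move=> gt0; have /cards1P[j ->] : #|Y :\: X| == 1%N by lia.
  exists (rat_col j); split=> [|i]; first by rewrite dim_vline leq_b1.
  by rewrite inE => /eqP ->; exact: memv_line.
apply: leq_trans (_ : \dim (col_space X + <[j]>) <= _)%N.
  apply/dimvS/col_space_sub => i iY; case: (boolP (i \in X)) => iX.
    by apply: subvP (addvSl _ _) _ _; exact: rat_col_in.
  apply: subvP (addvSr _ _) _ _; apply: sj.2.
  by rewrite inE iX.
apply: leq_trans (dimv_add_leqif _ _).1 _.
by rewrite -[X in (_ <= X)%N]addn1; apply: leq_add (leqnn _) sj.1.
Qed.

(** Up to a constant, [meet_dim] is the dimension of the span of the set plus that of its
    complement. Moving one column across raises one of them by at most 1 and lowers the other by at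
    most 1. *)
Lemma meet_dim_near (X Y : {set 'I_n}) : X \subset Y -> (#|Y :\: X| <= 1)%N ->
  (meet_dim X <= (meet_dim Y).+1)%N /\ (meet_dim Y <= (meet_dim X).+1)%N.
Proof.
move=> sXY le1.
have eC : Y :\: X = ~: X :\: ~: Y by apply/setP => i; rewrite !inE negbK andbC.
have hX := meet_dim_rank X; have hY := meet_dim_rank Y.
have h1 := dim_col_space_near le1.
rewrite eC in le1; have h2 := dim_col_space_near le1.
have h3 := dimvS (col_spaceS sXY).
have h4 : (\dim (col_space (~: Y)) <= \dim (col_space (~: X)))%N.
  by apply/dimvS/col_spaceS; rewrite setCS.
lia.
Qed.

End ColumnSpaces.

(** Unless [S] has at most one element, two members differ in some coordinate [r]. Split [S] into
    [d + 1] classes by the value of that coordinate. Inside a class all differences lie in [V] cut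
    by the hyperplane where coordinate [r] vanishes, and this is a proper subspace, so induction on
    the dimension applies. *)
Lemma size_box_le (m d k : nat) (V : {vspace 'cV[rat]_m}) (S : seq 'cV[int]_m) :
  (\dim V <= k)%N -> uniq S ->
  (forall y, y \in S -> forall r, 0 <= y r 0 <= d%:Z) ->
  (forall y z, y \in S -> z \in S -> map_mx intr (y - z) \in V) ->
  (size S <= (d + 1) ^ k)%N.
Proof.
elim: k V S => [|k IHk] V S dimV uS box SV.
  rewrite leqn0 dimv_eq0 in dimV; move/eqP: dimV => V0.
  case: S uS SV {box} => [|y [|z S]] //= /andP[]; rewrite inE negb_or.
  move=> /andP[yz _] _ /(_ y z); rewrite !inE !eqxx orbT V0 memv0.
  move=> /(_ isT isT) h; case/negP: yz.
  rewrite -subr_eq0; apply/eqP/matrixP => i j; move/eqP/matrixP/(_ i j): h.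
  by rewrite !mxE => /eqP; rewrite intr_eq0 => /eqP.
have [/allP e|] := boolP (all (fun y => y == head 0 S) S).
  have pos : (0 < (d + 1) ^ k.+1)%N by rewrite expn_gt0 addn1.
  case: S uS e {box SV} => [|y [|z S]] //= /andP[]; rewrite inE => + _ e.
  by rewrite eq_sym e // !inE eqxx orbT.
move=> /allPn[z zS zh].
have hS : head 0 S \in S by case: (S) zS => // y S' _; rewrite /= inE eqxx.
have [r zr] : exists r, z r 0 != head 0 S r 0.
  apply/existsP; apply: contraNT zh => /existsPn h.
  by apply/eqP/matrixP => i j; rewrite ord1; apply/eqP; have := h i; rewrite negbK.
pose V' := (V :&: lker (linfun (@row rat m 1 r)))%VS.
have dimV' : (\dim V' <= k)%N.
  rewrite -ltnS; apply: leq_trans dimV; rewrite ltn_neqAle dimvS ?capvSl // andbT.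
  have sV : (V' <= V)%VS by exact: capvSl.
  apply/negP => /eqP e; have {}e : V' = V by apply/eqP; rewrite eqEdim sV e /=.
  have : map_mx intr (z - head 0 S) \in V' by rewrite e SV.
  rewrite memv_cap memv_ker lfunE /= => /andP[_ /eqP/matrixP/(_ 0 0)].
  rewrite !mxE => /eqP; rewrite intr_eq0 subr_eq0.
  exact/negP.
have sizeE : size S = (\sum_(a < d.+1) size [seq y : 'cV_m <- S | y r 0%R == a%:Z])%N.
  under eq_bigr do rewrite size_filter -sum1_count.
  rewrite (exchange_big_dep xpredT) //= -sum1_size big_seq [RHS]big_seq.
  apply: eq_bigr => y yS; have /andP[y0 yd] := box y yS r.
  have lt_yd : (absz (y r 0%R) < d.+1)%N by lia.
  rewrite (big_pred1 (Ordinal lt_yd)) // => a /=.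
  apply/eqP/eqP => [e|->]; last by rewrite /= gez0_abs.
  by apply/val_inj; rewrite /= e.
rewrite sizeE expnS addn1 -[X in (_ <= X * _)%N]card_ord -sum_nat_const.
apply: leq_sum => a _; rewrite -[d.+1 in X in (_ <= X)%N]addn1; apply: IHk dimV' _ _ _.
- exact: filter_uniq.
- by move=> y; rewrite mem_filter => /andP[_]; exact: box.
move=> y y'; rewrite !mem_filter => /andP[/eqP ya yS] /andP[/eqP y'a y'S].
rewrite memv_cap SV //= memv_ker lfunE /=; apply/eqP/matrixP => i j.
by rewrite !mxE [j]ord1 ya y'a subrr.
Qed.

(** * The backward sweep and the layers of partial sums *)

(* The Gram-Schmidt step on projections; it is the identity when [M *m c = 0],
   since [0^-1 = 0]. *)
Definition proj_step (m : nat) (M : 'M[rat]_m) (c : 'cV[rat]_m) : 'M[rat]_m :=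
  let v := M *m c in M - ((v^T *m v) 0 0)^-1 *: (v *m v^T).

(* [M] is the orthogonal projection onto the complement of [W]. *)
Definition is_coprojector (m : nat) (M : 'M[rat]_m) (W : {vspace 'cV[rat]_m}) :=
  [/\ M^T = M, forall x, x \in W -> M *m x = 0 & forall x, x - M *m x \in W].

(** A sum of rational squares vanishes only termwise; so the norm in [proj_step] is zero only when
    there is no direction to remove. *)
Lemma norm_mx_eq0 (m : nat) (v : 'cV[rat]_m) : (v^T *m v) 0 0 = 0 -> v = 0.
Proof.
rewrite mxE; under eq_bigr do rewrite mxE -expr2.
move=> /eqP; rewrite psumr_eq0 => [/allP h|i _]; last exact: sqr_ge0.
apply/matrixP => i j; rewrite ord1 mxE; apply/eqP.
by have := h i (mem_index_enum _); rewrite sqrf_eq0.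
Qed.

(** * Orthogonal projections when a vector joins the space *)

Section Coprojector.
Variables (m : nat) (M : 'M[rat]_m) (W : {vspace 'cV[rat]_m}).
Hypothesis MW : is_coprojector M W.

Lemma coprojector_idem (c : 'cV_m) : M *m (M *m c) = M *m c.
Proof.
case: MW => _ M0 MD; apply/eqP; rewrite -subr_eq0 -opprB oppr_eq0 -mulmxBr.
by apply/eqP/M0.
Qed.

Lemma coprojector_orth (c x : 'cV_m) : x \in W -> (M *m c)^T *m x = 0.
Proof. by case: MW => symM M0 _ xW; rewrite trmx_mul symM -mulmxA M0 // mulmx0. Qed.

Lemma coprojector_norm (c : 'cV_m) : (M *m c)^T *m c = (M *m c)^T *m (M *m c).
Proof.
by case: MW => symM _ _; rewrite !trmx_mul symM -!mulmxA coprojector_idem.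
Qed.

(** This is why one linear test is enough. Write [x] as [t c + w] with [w] in [W]: pairing with
    [M c] gives [t] times the squared norm of [M c]. So either [t = 0], or [M c = 0] and [c] is
    itself in [W]. *)
Lemma coprojector_ker (c x : 'cV_m) :
  x \in (<[c]> + W)%VS -> (M *m c)^T *m x = 0 -> x \in W.
Proof.
case: MW => _ _ MD /memv_addP[_ /vlineP[t ->] [w wW ->]].
rewrite mulmxDr (coprojector_orth _ wW) addr0 -scalemxAr coprojector_norm.
move=> /eqP; rewrite scaler_eq0 => /orP[/eqP ->|/eqP/matrixP/(_ 0 0)].
  by rewrite scale0r add0r.
rewrite [RHS]mxE => /norm_mx_eq0 Mc0; apply: memvD => //; apply: memvZ.
by have := MD c; rewrite Mc0 subr0.
Qed.

Lemma proj_stepP (c : 'cV_m) : is_coprojector (proj_step M c) (<[c]> + W)%VS.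
Proof.
case: (MW) => symM M0 MD; rewrite /proj_step; set v := M *m c.
have vE x : ((v^T *m v) 0 0)^-1 *: (v *m v^T) *m x =
    ((v^T *m v) 0 0)^-1 * (v^T *m x) 0 0 *: v.
  by rewrite -scalemxAl -mulmxA {1}[v^T *m x]mx11_scalar mul_mx_scalar scalerA.
(* [v] is [c] minus the component [c - M c], which lies in [W]. *)
have vW : v \in (<[c]> + W)%VS.
  rewrite -[v](subKr c); apply: memvB.
    by apply: subvP (addvSl _ _) _ (memv_line _).
  by apply: subvP (addvSr _ _) _ (MD c).
split.
- by rewrite linearB linearZ /= (trmx_mul v) trmxK symM.
- move=> _ /memv_addP[_ /vlineP[t ->] [w wW ->]].
  rewrite mulmxDr mulmxBl [X in _ + X]mulmxBl (M0 w) // !vE -!scalemxAr.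
  rewrite (coprojector_orth _ wW) coprojector_norm -/v.
  have sE (a : rat) (B : 'M_1) : (a *: B) 0 0 = a * B 0 0 by rewrite mxE.
  rewrite sE [(0 : 'M_1) 0 0]mxE mulr0 scale0r subr0 addr0 mulrCA.
  set s := (v^T *m v) 0 0.
  have [s0|s0] := eqVneq s 0; first by rewrite (norm_mx_eq0 s0) !scaler0 subr0.
  by rewrite mulVf // mulr1 subrr.
move=> x; rewrite mulmxBl vE opprB addrA; rewrite addrAC; apply: memvD.
  by apply: subvP (addvSr _ _) _ (MD x).
exact: memvZ.
Qed.

End Coprojector.

Lemma coprojector1 (m : nat) : is_coprojector (1%:M : 'M[rat]_m) 0%VS.
Proof.
split=> [|x|x]; first by rewrite trmx1.
  by rewrite memv0 => /eqP ->; rewrite mulmx0.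
by rewrite mul1mx subrr mem0v.
Qed.

(** * Layers: invariants, size bound and completeness *)

Section Sweep.
Variables (m : nat) (C : nat -> 'cV[int]_m) (b : 'cV[int]_m) (K d : nat).

Definition ratv (v : 'cV[int]_m) : 'cV[rat]_m := map_mx intr v.

Lemma ratvD (u v : 'cV[int]_m) : ratv (u + v) = ratv u + ratv v.
Proof. by rewrite /ratv map_mxD. Qed.

Lemma ratvZ (a : int) (v : 'cV[int]_m) : ratv (a *: v) = a%:~R *: ratv v.
Proof. by rewrite /ratv map_mxZ. Qed.

Lemma ratvN (v : 'cV[int]_m) : ratv (- v) = - ratv v.
Proof. by rewrite /ratv map_mxN. Qed.

Lemma ratv_sum (I : Type) (r : seq I) (P : pred I) (F : I -> 'cV[int]_m) :
  ratv (\sum_(i <- r | P i) F i) = \sum_(i <- r | P i) ratv (F i).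
Proof. by rewrite /ratv map_mx_sum. Qed.

Definition prefix_space (k : nat) : {vspace 'cV[rat]_m} :=
  (\sum_(i < k) <[ratv (C i)]>)%VS.

Definition suffix_space (k : nat) : {vspace 'cV[rat]_m} :=
  (\sum_(k <= i < K) <[ratv (C i)]>)%VS.

(* The suffixes are swept from the last column to the first one. *)
Fixpoint sweep (t : nat) : 'M[rat]_m :=
  if t is t'.+1 then proj_step (sweep t') (ratv (C (K - t'.+1))) else 1%:M.

(** There are [K - k.+1] columns after the column [k], so this is the component of that column
    orthogonal to all later ones. *)
Definition functional (k : nat) : 'cV[rat]_m :=
  sweep (K - k.+1) *m ratv (C k).

Lemma suffix_space_ltn k : (k < K)%N ->
  suffix_space k = (<[ratv (C k)]> + suffix_space k.+1)%VS.
Proof. by move=> lt_kK; rewrite /suffix_space big_ltn. Qed.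

Lemma sweepP t : (t <= K)%N -> is_coprojector (sweep t) (suffix_space (K - t)).
Proof.
elim: t => [|t IHt] le_tK.
  by rewrite subn0 /suffix_space big_geq //; exact: coprojector1.
have lt_k : (K - t.+1 < K)%N by lia.
rewrite (suffix_space_ltn lt_k) -subSn // subSS; apply: proj_stepP.
by apply: IHt; exact: ltnW.
Qed.

Lemma sweep_functional k : (k < K)%N ->
  is_coprojector (sweep (K - k.+1)) (suffix_space k.+1).
Proof.
move=> lt_kK; have := @sweepP (K - k.+1).
by rewrite subKn //; apply; rewrite leq_subr.
Qed.

Lemma functional_orth k x : (k < K)%N -> x \in suffix_space k.+1 ->
  (functional k)^T *m x = 0.
Proof. by move=> /sweep_functional P; exact: coprojector_orth P _ _. Qed.

Lemma functional_ker k x : (k < K)%N -> x \in suffix_space k ->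
  (functional k)^T *m x = 0 -> x \in suffix_space k.+1.
Proof.
move=> lt_kK; rewrite suffix_space_ltn //.
exact: coprojector_ker (sweep_functional lt_kK) _ _.
Qed.

Lemma mem_suffix_space k i : (k <= i < K)%N -> ratv (C i) \in suffix_space k.
Proof.
move=> h; rewrite /suffix_space (bigD1_seq i) ?mem_index_iota ?iota_uniq //=.
by apply: subvP (addvSl _ _) _ (memv_line _).
Qed.

Definition residual (f : 'cV[rat]_m) (z : 'cV[int]_m) : rat :=
  \sum_r f r 0 * (z r 0 - b r 0)%:~R.

Lemma residualE f z : residual f z = (f^T *m ratv (z - b)) 0 0.
Proof. by rewrite mxE; apply: eq_bigr => r _; rewrite !mxE. Qed.

Lemma residualD f z c :
  residual f (z + c) = residual f z + (f^T *m ratv c) 0 0.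
Proof.
have addE (B B' : 'M[rat]_1) : (B + B') 0 0 = B 0 0 + B' 0 0 by rewrite mxE.
by rewrite !residualE -addE -mulmxDr -ratvD addrAC.
Qed.

Definition admissible (f : 'cV[rat]_m) (z : 'cV[int]_m) : bool :=
  [forall r, z r 0 <= b r 0] && (residual f z == 0).

(* Duplicate sums have to be dropped for the bound on the size of the layers. *)
Definition insert f (T : seq 'cV[int]_m) (z : 'cV[int]_m) : seq 'cV[int]_m :=
  if admissible f z && (z \notin T) then rcons T z else T.

Definition extend f (c : 'cV[int]_m) (T : seq 'cV[int]_m) (y : 'cV[int]_m) :=
  foldl (insert f) T [seq y + j%:Z *: c | j <- iota 0 d.+1].

Fixpoint layer (k : nat) : seq 'cV[int]_m :=
  if k is k'.+1 then foldl (extend (functional k') (C k')) [::] (layer k')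
  else [:: 0].

Lemma mem_insert f T z z' :
  (z' \in insert f T z) = (z' \in T) || admissible f z' && (z' == z).
Proof.
rewrite /insert; case: (boolP (_ && _)) => [/andP[a _]|].
  by rewrite mem_rcons inE orbC; case: eqP => [->|]; rewrite ?a ?andbT ?andbF.
rewrite negb_and negbK; case: eqP => [->|]; last by rewrite andbF orbF.
by rewrite andbT; case: admissible; rewrite ?orbF ?orbT //= => ->.
Qed.

Lemma mem_foldl_insert f T P z :
  (z \in foldl (insert f) T P) = (z \in T) || admissible f z && (z \in P).
Proof.
elim: P T => [|y P IHP] T /=; first by rewrite andbF orbF.
by rewrite IHP mem_insert inE andb_orr orbA.
Qed.

Lemma uniq_foldl_insert f T P : uniq T -> uniq (foldl (insert f) T P).
Proof.
elim: P T => [|y P IHP] T //= uT; apply: IHP.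
by rewrite /insert; case: ifP => // /andP[_ yT]; rewrite rcons_uniq yT.
Qed.

Lemma mem_foldl_extend f c T L z :
  (z \in foldl (extend f c) T L) = (z \in T) ||
    admissible f z && has (fun y => z \in [seq y + j%:Z *: c | j <- iota 0 d.+1]) L.
Proof.
elim: L T => [|y L IHL] T /=; first by rewrite andbF orbF.
by rewrite IHL mem_foldl_insert andb_orr orbA.
Qed.

Lemma mem_layerS k z : reflect
    (admissible (functional k) z /\ exists2 y, y \in layer k &
       exists2 j, (j <= d)%N & z = y + j%:Z *: C k)
    (z \in layer k.+1).
Proof.
have -> : layer k.+1 = foldl (extend (functional k) (C k)) [::] (layer k) by [].
rewrite mem_foldl_extend in_nil orFb.
apply: (iffP andP) => -[adm h]; split=> //.
  case/hasP: h => y yL /mapP[j]; rewrite mem_iota => /andP[_ lt_jd] ->.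
  by exists y => //; exists j.
case: h => y yL [j le_jd ->]; apply/hasP; exists y; first exact: yL.
by apply/mapP; exists j; first rewrite mem_iota.
Qed.

Lemma uniq_layer k : uniq (layer k).
Proof.
case: k => [|k] //=; have : uniq ([::] : seq 'cV[int]_m) by [].
elim: (layer k) [::] => [|y L IHL] T //= uT; apply: IHL.
exact: uniq_foldl_insert.
Qed.

Hypothesis C_ge0 : forall k r, 0 <= C k r 0.
Hypothesis b_le : forall r, b r 0 <= d%:Z.

Lemma layer_box k y r : y \in layer k -> 0 <= y r 0 <= d%:Z.
Proof.
elim: k y => [|k IHk] y; first by rewrite inE => /eqP ->; rewrite mxE lexx.
move=> /mem_layerS[/andP[/forallP /(_ r) le_b _] [z /IHk/andP[z0 _] [j _ yE]]].
rewrite (le_trans le_b) // andbT yE !mxE addr_ge0 // mulr_ge0 //.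
Qed.

Lemma layer_sum k y : y \in layer k ->
  exists x : nat -> nat, y = \sum_(i < k) (x i)%:Z *: C i.
Proof.
elim: k y => [|k IHk] y.
  by rewrite inE => /eqP ->; exists (fun=> 0%N); rewrite big_ord0.
move=> /mem_layerS[_ [z /IHk[x ->] [j _ ->]]].
exists (fun i => if i == k then j else x i).
rewrite big_ord_recr /= eqxx; congr (_ + _); apply: eq_bigr => i _.
by rewrite ltn_eqF.
Qed.

(** A test once passed stays passed: the columns added after step [i] are orthogonal to
    [functional i]. *)
Lemma layer_residual k y i : (k <= K)%N -> y \in layer k -> (i < k)%N ->
  residual (functional i) y = 0.
Proof.
elim: k y => [|k IHk] y // lt_kK /mem_layerS[/andP[_ /eqP r0] [z zL [j _ yE]]].
rewrite ltnS leq_eqVlt => /orP[/eqP -> //|lt_ik].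
have rz := IHk z (ltnW lt_kK) zL lt_ik.
rewrite yE residualD rz ratvZ add0r.
have lt_iK : (i < K)%N := ltn_trans lt_ik lt_kK.
rewrite functional_orth ?mxE //; apply: memvZ; apply: mem_suffix_space.
by rewrite lt_ik.
Qed.

Lemma layer_diff_prefix k y z : y \in layer k -> z \in layer k ->
  ratv (y - z) \in prefix_space k.
Proof.
have h u : u \in layer k -> ratv u \in prefix_space k.
  move=> /layer_sum[x ->]; rewrite /ratv map_mx_sum; apply: memv_sumr => i _.
  by rewrite -/(ratv _) ratvZ; apply: memvZ; exact: memv_line.
by move=> /h yV /h zV; rewrite /ratv map_mxB; exact: memvB.
Qed.

(** The difference starts in the span of all columns. As [y] and [z] both pass test [i], their
    difference is orthogonal to [functional i], and by [functional_ker] it can do without column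
    [i]; this is repeated for each [i] below [k]. *)
Lemma layer_diff_suffix k y z : (k <= K)%N -> y \in layer k -> z \in layer k ->
  ratv (y - z) \in suffix_space k.
Proof.
move=> le_kK yL zL.
suff h i : (i <= k)%N -> ratv (y - z) \in suffix_space i by exact: h.
elim: i => [|i IHi] le_ik.
  apply: subvP (layer_diff_prefix yL zL); apply/subv_sumP => i _.
  rewrite -memvE; apply: mem_suffix_space; exact: leq_trans le_kK.
have lt_iK : (i < K)%N by exact: leq_trans le_kK.
apply: functional_ker => //; first by apply: IHi; exact: ltnW.
apply/matrixP => u v; rewrite !ord1 [RHS]mxE.
have /(congr1 (residual (functional i))) : z + (y - z) = y by rewrite addrC subrK.
by rewrite residualD !(layer_residual le_kK) // add0r.
Qed.

Lemma size_layer k kappa : (k <= K)%N ->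
  (\dim (prefix_space k :&: suffix_space k) <= kappa)%N ->
  (size (layer k) <= (d + 1) ^ kappa)%N.
Proof.
move=> le_kK dimV; apply: size_box_le dimV (uniq_layer k) _ _.
  by move=> y yL r; exact: layer_box yL.
move=> y z yL zL; rewrite memv_cap; apply/andP; split.
  exact: layer_diff_prefix.
exact: layer_diff_suffix.
Qed.

(** The terms of a solution still to be added are nonnegative and lie in the suffix space, so its
    partial sums stay below [b] and pass every test. *)
Lemma layer_complete (x : nat -> nat) k : (k <= K)%N ->
  b = \sum_(i < K) (x i)%:Z *: C i ->
  \sum_(i < k) (x i)%:Z *: C i \in layer k.
Proof.
move=> + bE; elim: k => [|k IHk] lt_kK; first by rewrite big_ord0 inE.
have restE : b = \sum_(i < k.+1) (x i)%:Z *: C i +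
    \sum_(k.+1 <= i < K) (x i)%:Z *: C i.
  by rewrite bE -!(big_mkord xpredT (fun i => (x i)%:Z *: C i)) -big_cat_nat.
set z := \sum_(i < k.+1) _ in restE *.
have term_ge0 i r : 0 <= ((x i)%:Z *: C i) r 0 by rewrite mxE mulr_ge0.
have le_b r : z r 0 <= b r 0.
  rewrite restE [leRHS]mxE lerDl summxE; exact: sumr_ge0.
apply/mem_layerS; split.
  apply/andP; split; first by apply/forallP.
  have -> : residual (functional k) z = - ((functional k)^T *m
      ratv (\sum_(k.+1 <= i < K) (x i)%:Z *: C i)) 0 0.
    by rewrite residualE restE opprD addrA subrr sub0r ratvN mulmxN [LHS]mxE.
  rewrite functional_orth ?[_ 0 0]mxE ?oppr0 //.
  rewrite ratv_sum big_seq; apply: memv_suml => i; rewrite mem_index_iota => h.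
  by rewrite ratvZ; apply: memvZ; exact: mem_suffix_space.
exists (\sum_(i < k) (x i)%:Z *: C i); first by apply: IHk; exact: ltnW.
(* The multiplicity [x k] may exceed [d] only for a zero column, where multiplicity 0 gives the same
   sum. Otherwise some entry of the column is at least 1, and [x k] is at most the entry of [b] in
   that row. *)
have [C0|[r Cr]] : C k = 0 \/ exists r, C k r 0 != 0.
  have [/existsP|/existsPn h] := boolP [exists r, C k r 0 != 0]; first by right.
  left; apply/matrixP => i j; rewrite ord1 mxE; apply/eqP; have := h i.
  by rewrite negbK.
  by exists 0%N => //; rewrite /z big_ord_recr /= C0 !scaler0.
exists (x k); last by rewrite /z big_ord_recr.
have := le_trans (le_b r) (b_le r); rewrite /z big_ord_recr /= mxE.
rewrite summxE; have := C_ge0 k r.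
have : 0 <= \sum_(i < k) ((x i)%:Z *: C i) r 0 by exact: sumr_ge0.
rewrite [((x k)%:Z *: C k) r 0]mxE; move: (\sum_(i < k) _) (C k r 0) Cr (x k).
by move=> s c c0 a s0 c1; nia.
Qed.

Lemma layer_feasible :
  b \in layer K <-> exists x : nat -> nat, b = \sum_(i < K) (x i)%:Z *: C i.
Proof.
split=> [/layer_sum //|[x bE]].
by rewrite {1}bE; exact: layer_complete.
Qed.

End Sweep.

(** * The linear order of a caterpillar *)

Section PathDecomposition.
Local Open Scope nat_scope.
Variables (n : nat) (D : labelled_graph n).
Local Notation vertex := 'I_(n_vertices D).
Local Notation adj := (@adj n D).
Local Notation is_leaf := (@is_leaf n D).

Lemma adjC : symmetric adj.
Proof. by move=> u v; rewrite /Defs.adj orbC. Qed.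

Lemma degreeE (u : vertex) : degree u = \sum_(w | adj u w) 1.
Proof. by rewrite /degree sum1dep_card. Qed.

Hypothesis D_simple : simple_edges D.

Lemma adj_irrefl v : adj v v = false.
Proof.
case: D_simple => _ h; rewrite /Defs.adj orbb; apply/negP => vv.
by have := h _ _ vv; rewrite vv.
Qed.

(** Each neighbour of [v] comes from exactly one listed edge, in one of the two orientations. This
    serves both the handshake count and the pass of the program over the edge list. *)
Lemma sum_edges (g : vertex -> nat) v :
  \sum_(e <- edges D) ((e.1 == v) * g e.2 + (e.2 == v) * g e.1) =
  \sum_(u | adj v u) g u.
Proof.
case: D_simple => uE simpleE.
have big_edges (F : vertex * vertex -> nat) :
    \sum_(e <- edges D) F e = \sum_x \sum_y ((x, y) \in edges D) * F (x, y).
  rewrite big_uniq //= pair_big /= big_mkcond; apply: eq_bigr => -[x y] _ /=.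
  by case: ifP => _; rewrite ?mul1n.
rewrite big_split !big_edges /= [X in _ + X]exchange_big /=.
rewrite -big_split /= (bigD1 v) //= [X in _ + X]big1 ?addn0 => [|x xv]; last first.
  by rewrite !big1 // => y _; rewrite (negPf xv) muln0.
rewrite -big_split [RHS]big_mkcond /=; apply: eq_bigr => u _.
rewrite eqxx !mul1n /Defs.adj; have := simpleE v u.
case: ((v, u) \in edges D) => [/(_ isT)/negPf -> | _] /=; first by lia.
by case: ((u, v) \in edges D); rewrite /=; lia.
Qed.

Lemma leaf_adj v u w : is_leaf v -> adj v u -> adj v w -> u = w.
Proof.
move=> lv vu vw; apply: contraTeq lv => uw; rewrite /Defs.is_leaf -ltnNge.
rewrite /degree (cardD1 u) (cardD1 w) !inE vu vw eq_sym uw.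
by [].
Qed.

Hypothesis D_cubic : is_cubic D.

Lemma degree_le3 (v : vertex) : degree v <= 3.
Proof.
have [|/D_cubic ->//] := boolP (is_leaf v).
by rewrite /Defs.is_leaf => /leq_trans; apply.
Qed.

Lemma size_edges_le : 2 * size (edges D) <= 3 * n_vertices D.
Proof.
have <- : \sum_(v : vertex) degree v = 2 * size (edges D).
  have one (a : vertex) : \sum_(v : vertex) (a == v) * 1 = 1.
    by rewrite (bigD1 a) //= eqxx big1 // => v /negPf; rewrite eq_sym => ->.
  under eq_bigr do rewrite degreeE -(sum_edges (fun=> 1)).
  rewrite exchange_big /= -sum1_size big_distrr /=; apply: eq_bigr => e _.
  by rewrite big_split /= !one.
rewrite -[X in 3 * X]card_ord mulnC -sum_nat_const; apply: leq_sum => v _.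
exact: degree_le3.
Qed.

(** The internal vertices in the order of an induced path. The path in the definition of a
    caterpillar may end in leaves; this one contains none, and may be empty. *)
Definition is_spine (q : seq vertex) : Prop :=
  [/\ uniq q, forall v, (v \in q) = ~~ is_leaf v
    & forall v0 i j, i < size q -> j < size q ->
        adj (nth v0 q i) (nth v0 q j) = (i.+1 == j) || (j.+1 == i)].

Lemma is_spine_rev q : is_spine q -> is_spine (rev q).
Proof.
move=> [uq mq aq]; split=> [|v|v0 i j]; rewrite ?rev_uniq ?mem_rev //.
rewrite size_rev => hi hj; rewrite !nth_rev // aq; lia.
Qed.

Hypothesis D_caterpillar : is_caterpillar D.

Lemma D_connected u v : connect adj u v.
Proof. by case: D_caterpillar => -[_ h _] _; exact: h. Qed.

(** The predecessor and the successor of [y] are two neighbours, distinct because the path has no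
    repetition. *)
Lemma inner_not_leaf (a z y : vertex) (s1 s2 : seq vertex) :
  path adj a (rcons (s1 ++ y :: s2) z) -> uniq (a :: rcons (s1 ++ y :: s2) z) ->
  ~~ is_leaf y.
Proof.
rewrite rcons_cat rcons_cons cat_path => /andP[_ /andP[ay yz]].
rewrite cons_uniq mem_cat negb_or cat_uniq.
move=> /andP[/andP[as1 as2] /and3P[_ /hasPn dis _]].
have [b [s3 eb]] : exists b s3, rcons s2 z = b :: s3.
  by case: (s2) => [|b s3]; [exists z, [::] | exists b, (rcons s3 z)].
move: yz; rewrite eb /= => /andP[yb _].
apply/negP => ly; have := leaf_adj ly yb (w := last a s1).
rewrite adjC ay => /(_ isT) eb'.
have bs : b \in y :: rcons s2 z by rewrite eb !inE eqxx orbT.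
have := mem_last a s1; rewrite -eb' inE => /orP[/eqP ba|bs1].
  by move: as2; rewrite -ba bs.
by have := dis _ bs; rewrite /= bs1.
Qed.

(** Off the given path all vertices are leaves, and on it only the two ends can be, so dropping the
    leaves keeps a path. It is induced because the tree is acyclic. *)
Lemma spine_exists : exists q, is_spine q.
Proof.
case: D_caterpillar => -[N0 conn acyc] [x [p [path_p uniq_p attached]]].
pose inner (v : vertex) := ~~ is_leaf v.
have sorted_q : sorted adj (filter inner (x :: p)).
  case: (lastP p) path_p uniq_p => [|s z] path_p uniq_p /=.
    by case: (inner x).
  have inner_s : filter inner s = s.
    apply/all_filterP/allP => y ys; move: path_p uniq_p.
    by case/splitPr: ys => s1 s2; exact: inner_not_leaf.
  rewrite filter_rcons inner_s; move: path_p; rewrite rcons_path => /andP[xs sz].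
  case: (inner x); case: (inner z); rewrite /= ?rcons_path ?xs ?sz //.
    by case: (s) xs sz => //= y s' /andP[_ ys] sz; rewrite rcons_path ys.
  exact: path_sorted xs.
exists (filter inner (x :: p)); set q := filter _ _ in sorted_q *.
have uq : uniq q by exact: filter_uniq.
split=> // [v|].
  rewrite mem_filter /inner; case: (boolP (is_leaf v)) => //= lv.
  apply: contraNT lv => /attached[dv _]; by rewrite /Defs.is_leaf dv.
have lt_adj v0 i j : i < j -> j < size q -> adj (nth v0 q i) (nth v0 q j) = (i.+1 == j).
  move=> lt_ij lt_jq; apply/idP/eqP => [ij|<-]; last first.
    by apply: (sortedP v0 sorted_q); lia.
  apply/eqP; rewrite eqn_leq lt_ij leqNgt /=; apply/negP => lt_i1j.
  (* A chord would close this stretch of the path into a cycle with at least three vertices. *)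
  pose c := drop i (take j.+1 q).
  have size_c : size c = j.+1 - i by rewrite size_drop size_takel.
  have nth_c k : k < j.+1 - i -> nth v0 c k = nth v0 q (i + k).
    by move=> h; rewrite nth_drop nth_take //; lia.
  have := acyc c; rewrite size_c => h; suff /h : ucycle adj c by lia.
  apply/andP; split; last by rewrite drop_uniq // take_uniq.
  have : sorted adj c by apply/drop_sorted/take_sorted.
  case ec: c => [|a s] //= as_; rewrite rcons_path as_ /=.
  have ea : a = nth v0 q i by rewrite -[i]addn0 -nth_c ?ec //; lia.
  have el : last a s = nth v0 q j.
    rewrite (last_nth v0) -/(nth v0 (a :: s) _) -ec.
    have -> : size s = j - i by move: size_c; rewrite ec /=; lia.
    by rewrite nth_c; [congr nth; lia | lia].
  by rewrite el ea adjC.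
move=> v0 i j hi hj; have [lt_ij|lt_ji|->] := ltngtP i j.
- rewrite lt_adj //; lia.
- rewrite adjC lt_adj //; lia.
- rewrite adj_irrefl; lia.
Qed.

Hypothesis D_labels : labels_leaves D.

Lemma label_leaf j : is_leaf (label D j).
Proof. by case: D_labels => _ <-; exact: codom_f. Qed.

Lemma leaf_label v : is_leaf v -> exists j, v = label D j.
Proof. by case: D_labels => _ <- /codomP. Qed.

(** * The spine and the columns hanging from it *)

Section Spine.
Variable q : seq vertex.
Hypothesis q_spine : is_spine q.

Lemma mem_spine v : (v \in q) = ~~ is_leaf v.
Proof. by case: q_spine. Qed.

(** Leaves correspond to columns, so the machine obtains the length of the spine by subtracting two
    of its inputs. *)
Lemma n_vertices_spine : n_vertices D = n + size q.
Proof.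
rewrite -[LHS]card_ord -(cardC is_leaf); congr (_ + _).
  rewrite -[RHS]card_ord -(card_codom (proj1 D_labels)).
  by apply: eq_card => v; case: D_labels => _ ->.
have [uq _ _] := q_spine; rewrite -(card_uniqP uq); apply: eq_card => v.
by rewrite mem_spine !inE.
Qed.

(** Used with [g = 1] to recognise the ends of the spine, and with [g] the vertex number to step
    from one spine vertex to the next. *)
Lemma spine_sum (g : vertex -> nat) v0 i : i < size q ->
  \sum_(w | adj (nth v0 q i) w && ~~ is_leaf w) g w =
  (if 0 < i then g (nth v0 q i.-1) else 0) +
  (if i.+1 < size q then g (nth v0 q i.+1) else 0).
Proof.
case: q_spine => uq mq aq lt_iq.
have -> : \sum_(w | adj (nth v0 q i) w && ~~ is_leaf w) g w =
    \sum_(w <- q) if adj (nth v0 q i) w then g w else 0.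
  by rewrite big_uniq //= -big_mkcondr; apply: eq_bigl => w; rewrite mq andbC.
rewrite (big_nth v0).
transitivity (\sum_(0 <= j < size q)
   ((if j.+1 == i then g (nth v0 q j) else 0) +
    (if j == i.+1 then g (nth v0 q j) else 0))).
  apply: eq_big_nat => j /andP[_ lt_jq]; rewrite aq //.
  have -> : (i.+1 == j) = (j == i.+1) by rewrite eq_sym.
  by case: (j =P i.+1) => h1; case: (j.+1 =P i) => h2 /=; lia.
rewrite big_split -!big_mkcond /= big_nat1_eq /=; congr (_ + _).
case: i lt_iq => [|i] lt_iq; first by rewrite big1.
by rewrite big_nat1_eq /= ltnW.
Qed.

(** Two adjacent leaves would form a connected component on their own, leaving no place for a spine
    vertex. *)
Lemma leaf_spine v : is_leaf v -> 0 < size q ->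
  exists2 u, u \in q & forall w, adj v w = (w == u).
Proof.
move=> lv; case: (q) mem_spine => // z q' mq _.
have zI : ~~ is_leaf z by rewrite -mq inE eqxx.
have zv : z != v by apply: contraNneq zI => ->.
case/connectP: (D_connected v z) => -[|u p] /=; first by move=> _ e; rewrite e eqxx in zv.
move=> /andP[vu _] _; exists u; last first.
  by move=> w; apply/idP/eqP => [vw|->//]; exact: leaf_adj lv vw vu.
rewrite mq; apply/negP => lu.
have cl : closed adj (pred2 v u).
  apply: intro_closed => [|x y xy]; first by apply: sym_connect_sym; exact: adjC.
  rewrite !inE => /orP[] /eqP xE; rewrite xE in xy.
    by rewrite (leaf_adj lv xy vu) eqxx orbT.
  by rewrite adjC in vu; rewrite (leaf_adj lu xy vu) eqxx.
have := closed_connect cl (D_connected v z).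
by rewrite !inE eqxx /= (negPf zv) /= => /esym/eqP e; move: zI; rewrite e lu.
Qed.

(** Positions start at 1, so that an unwritten array cell, which holds 0, stands for a vertex off
    the spine. *)
Definition place (v : vertex) : nat := if v \in q then (index v q).+1 else 0.

Lemma place_le v : place v <= size q.
Proof. by rewrite /place; case: ifP => // vq; rewrite index_mem. Qed.

(* The position on the spine of the vertex to which the column [j] is attached,
   counted from 1; it is 0 when there is no spine, that is, when [n <= 2]. *)
Definition key (j : 'I_n) : nat :=
  \sum_(u | adj (label D j) u && ~~ is_leaf u) place u.

Lemma keyP j : 0 < size q ->
  exists2 u, u \in q & (forall w, adj (label D j) w = (w == u)) /\ key j = place u.
Proof.
move=> q0; have [u uq au] := leaf_spine (label_leaf j) q0; exists u => //.
split=> //; rewrite /key (big_pred1 u) // => w; rewrite au /=.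
by case: eqP => //= ->; rewrite -mem_spine.
Qed.

Lemma key_nil j : size q = 0 -> key j = 0.
Proof.
move/size0nil => q0; rewrite /key big1 // => u _.
by rewrite /place q0.
Qed.

Lemma key_le j : key j <= size q.
Proof.
have [/(key_nil j) -> //|] := posnP (size q).
by move=> /(keyP j)[u _ [_ ->]]; exact: place_le.
Qed.

Lemma place_inj u v : u \in q -> v \in q -> place u = place v -> u = v.
Proof.
by rewrite /place => uq vq; rewrite uq vq => -[] /index_inj; exact.
Qed.

Lemma no_spine_le2 : size q = 0 -> n <= 2.
Proof.
move=> q0; have [->//|n0] := posnP n; pose v := label D (Ordinal n0).
have leaf u : is_leaf u by have := mem_spine u; rewrite (size0nil q0) in_nil; case: is_leaf.
have cl : closed adj [pred u | (u == v) || adj v u].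
  apply: intro_closed => [|x y xy]; first by apply: sym_connect_sym; exact: adjC.
  rewrite !inE => /orP[/eqP xE|vx]; first by rewrite -xE xy orbT.
  by rewrite adjC in vx; rewrite (leaf_adj (leaf x) xy vx) eqxx.
have all_in u : (u == v) || adj v u.
  by have := closed_connect cl (D_connected v u); rewrite !inE eqxx /= => <-.
have : #|'I_(n_vertices D)| <= 1 + degree v.
  rewrite -(cards1 v) -cardsUI; apply: leq_trans (leq_addr _ _).
  by apply/subset_leq_card/subsetP => u _; rewrite !inE.
rewrite card_ord n_vertices_spine q0 addn0; have := leaf v.
by rewrite /Defs.is_leaf; lia.
Qed.

(** Columns with the same key are neighbours of one spine vertex, of degree 3; without a spine there
    are at most two columns. *)
Lemma bucket_le3 j : #|[set i | key i == key j]| <= 3.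
Proof.
have [q0|q0] := posnP (size q).
  apply: leq_trans (max_card _) _; rewrite card_ord.
  exact: leq_trans (no_spine_le2 q0) _.
have [u uq [au ku]] := keyP j q0.
rewrite -(card_imset _ (proj1 D_labels)); apply: leq_trans (degree_le3 u).
apply/subset_leq_card/subsetP => _ /imsetP[i + ->]; rewrite !inE => /eqP ki.
have [v vq [av kv]] := keyP i q0.
by rewrite adjC av; apply/eqP/place_inj => //; rewrite -ku -kv.
Qed.

(** A spine vertex has degree 3 and at most two neighbours on the spine, so a leaf hangs from it.
    This bounds the length of the spine, and hence the number of slots, in terms of [n]. *)
Lemma key_surj i : i < size q -> exists j, key j = i.+1.
Proof.
move=> lt_iq; have [v0 _] : exists v0 : vertex, true.
  by case: (q) lt_iq => // v; exists v.
have [uq mq _] := q_spine.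
pose u := nth v0 q i; have uq' : u \in q by exact: mem_nth.
have d3 : degree u = 3 by apply: D_cubic; rewrite -mq.
have : \sum_(w | adj u w && ~~ is_leaf w) 1 <= 2.
  by rewrite (spine_sum (fun=> 1)) //; case: ifP => _; case: ifP.
move: d3; rewrite degreeE (bigID is_leaf) /= => d3 le2.
have : 0 < \sum_(w | adj u w && is_leaf w) 1.
  rewrite lt0n; apply/negP => /eqP z0; move: d3 le2.
  by rewrite z0 add0n => ->.
rewrite sum1dep_card => /card_gt0P[w].
rewrite inE => /andP[uw /leaf_label[j wE]].
exists j; have [|u' uq'' [au' ->]] := keyP j; first by lia.
move: uw; rewrite wE adjC au' => /eqP <-.
by rewrite /place uq' index_uniq.
Qed.

Lemma size_spine_le : size q <= n.
Proof.
have : {subset iota 1 (size q) <= map key (enum 'I_n)}.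
  move=> i; rewrite mem_iota => /andP[i0 lt_i].
  have [|j kj] := @key_surj i.-1; first by lia.
  by apply/mapP; exists j; rewrite ?mem_enum // kj prednK.
by move/(uniq_leq_size (iota_uniq _ _)); rewrite size_iota size_map size_enum_ord.
Qed.

End Spine.

(* Removing [e] leaves every vertex connected to [e.1] or to [e.2], so a function
   constant along the other edges that separates the two ends determines the
   displayed set. *)
Lemma displayed_side (e : vertex * vertex) (h : vertex -> bool) :
  e \in edges D -> (forall x y, adj_without e x y -> h x = h y) ->
  h e.1 != h e.2 -> displayed e = [set j | h (label D j) == h e.1].
Proof.
move=> eE hh he; have conn x y : connect (adj_without e) x y -> h x = h y.
  move=> /connectP[p]; elim: p x => [|z p IHp] x /=; first by move=> _ ->.
  by move=> /andP[/hh -> zp] /(IHp _ zp).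
have symE : connect_sym (adj_without e).
  by apply: sym_connect_sym => x y; rewrite /adj_without adjC andbA andbAC -andbA.
pose R := [pred v | connect (adj_without e) e.1 v || connect (adj_without e) e.2 v].
have cl : closed adj R.
  apply: intro_closed => [|x y xy]; first by apply: sym_connect_sym; exact: adjC.
  have [/eqP e1|n1] := boolP ((x, y) == e).
    by rewrite !inE -e1 /= !connect0 orbT.
  have [/eqP e2|n2] := boolP ((y, x) == e).
    by rewrite !inE -e2 /= !connect0.
  have xy' : adj_without e x y by rewrite /adj_without xy n1 n2.
  by rewrite !inE => /orP[] c; rewrite (connect_trans c (connect1 xy')) ?orbT.
apply/setP => j; rewrite !inE; set v := label D j.
have : v \in R.
  by rewrite -(closed_connect cl (D_connected e.1 v)) !inE connect0.
rewrite inE; case c1 : (connect _ e.1 v) => /=; first by rewrite (conn _ _ c1) eqxx.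
by move=> /conn <-; rewrite eq_sym; move: he; case: (_ == _).
Qed.

(** The spine edge between the indices [i.-1] and [i] displays this set or its complement, according
    to the orientation in which it is listed, and connectivity is the same for both. *)
Lemma cut_connectivity (m : nat) (A : 'M[int]_(m, n)) q i :
  is_spine q -> 0 < i < size q ->
  connectivity A [set j | key q j <= i] <= width D A.
Proof.
move=> qS /andP[i0 lt_iq]; have [uq mq aq] := qS.
have [v0 _] : exists v0 : vertex, true by case: (q) lt_iq => // v; exists v.
(* [rho] extends [key] to all vertices, a leaf inheriting the place of its spine neighbour.
   Comparing it with [i] is then constant along every edge but the chosen one. *)
pose rho v := if is_leaf v then \sum_(u | adj v u && ~~ is_leaf u) place q u
              else place q v.
pose h v := rho v <= i.
have rho_nth k : k < size q -> rho (nth v0 q k) = k.+1.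
  move=> lt_kq; have kq := mem_nth v0 lt_kq.
  by rewrite /rho -[is_leaf _]negbK -mq kq /place kq index_uniq.
have lt_i1q : i.-1 < size q by lia.
pose x := nth v0 q i.-1; pose y := nth v0 q i.
have xy : adj x y by rewrite /x /y aq //; lia.
have q0 : 0 < size q by lia.
have hh e : e = (x, y) \/ e = (y, x) ->
    forall u v, adj_without e u v -> h u = h v.
  move=> eE u v /and3P[uv uve vue].
  have leafcase s t : is_leaf s -> adj s t -> rho s = rho t.
    move=> ls st; have [w wq aw] := leaf_spine qS ls q0.
    move: st; rewrite aw => /eqP ->; rewrite /rho ls.
    rewrite mq in wq; rewrite (negPf wq) (big_pred1 w) // => r.
    by rewrite aw /=; case: eqP => // ->.
  have [lu|lu] := boolP (is_leaf u); first by rewrite /h (leafcase u v).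
  have [lv|lv] := boolP (is_leaf v); first by rewrite /h (leafcase v u) // adjC.
  rewrite -mq in lu; rewrite -mq in lv.
  move: uv uve vue; rewrite -(nth_index v0 lu) -(nth_index v0 lv).
  have := lu; have := lv; rewrite -!index_mem.
  move: (index u q) (index v q) => a c lt_c lt_a.
  rewrite aq // /h !rho_nth // => ac n1 n2.
  (* Adjacent spine vertices have consecutive indices; only the pair [i.-1], [i] straddles the
     threshold. *)
  suff : ~ (a = i /\ c = i.-1) /\ ~ (a = i.-1 /\ c = i) by lia.
  by split=> -[ea ec]; move: n1 n2; rewrite ea ec -/x -/y; case: eE => ->;
    rewrite eqxx.
have hx : h x = true by rewrite /h rho_nth; lia.
have hy : h y = false by rewrite /h rho_nth; lia.
have keyE j : (key q j <= i) = h (label D j).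
  by rewrite /h /rho label_leaf.
have wle e : e \in edges D -> connectivity A (displayed e) <= width D A.
  by move=> eE; exact: (@leq_bigmax_seq _ _ xpredT (fun e => connectivity A (displayed e))).
have := xy; rewrite /Defs.adj => /orP[] eE; apply: leq_trans (wle _ eE).
  rewrite (displayed_side eE (h := h)) ?hx ?hy //; last by apply: hh; left.
  by apply/eq_leq; congr connectivity; apply/setP => j; rewrite !inE keyE eqb_id.
rewrite (displayed_side eE (h := h)) ?hx ?hy //; last by apply: hh; right.
rewrite !connectivityE -(meet_dimC A [set j | key q j <= i]).
apply/eq_leq; congr (meet_dim _ _).+1; apply/setP => j.
by rewrite !inE keyE eqbF_neg.
Qed.

Lemma width_gt0 (m : nat) (A : 'M[int]_(m, n)) : 1 < n -> 0 < width D A.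
Proof.
move=> n1; pose x := label D (Ordinal (ltnW n1)); pose y := label D (Ordinal n1).
have xy : y != x by apply/eqP => /(proj1 D_labels)/(congr1 val).
case/connectP: (D_connected x y) => -[|z p] /=.
  by move=> _ e; rewrite e eqxx in xy.
move=> /andP[xz _] _.
have [e eE] : exists e, e \in edges D.
  by move: xz; rewrite /Defs.adj => /orP[]; [exists (x, z) | exists (z, x)].
apply: leq_trans (_ : connectivity A (displayed e) <= _).
  by rewrite connectivityE.
exact: (@leq_bigmax_seq _ _ xpredT (fun e => connectivity A (displayed e))).
Qed.

(** The machine may find either end; if it is the last vertex, the reversed spine begins there. *)
Lemma spine_start s : ~~ is_leaf s ->
  \sum_(w | adj s w && ~~ is_leaf w) 1 <= 1 ->
  exists2 q, is_spine q & 0 < size q /\ nth s q 0 = s.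
Proof.
move=> sI; have [q qS] := spine_exists; have [uq mq _] := qS.
have sq : s \in q by rewrite mq.
have lt_sq : index s q < size q by rewrite index_mem.
rewrite -{1}(nth_index s sq) (spine_sum qS (fun=> 1)) //.
have [s0 _|s0] := posnP (index s q).
  by exists q => //; rewrite -s0 nth_index //; split=> //; lia.
case: ltnP => // s1 _; exists (rev q); first exact: is_spine_rev.
rewrite size_rev nth_rev; last by lia.
have -> : size q - 1 = index s q by lia.
by rewrite nth_index //; split=> //; lia.
Qed.

(** * A linear order all of whose prefixes have small connectivity *)

Section Slots.
Variable q : seq vertex.
Hypothesis q_spine : is_spine q.

(* At most three columns have the same key, hence the factor 3 in [slot].  The
   columns in a slot below [i] form a set that differs by at most one element from
   a set displayed by a spine edge, from the empty set or from the full set. *)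
Definition rank (j : 'I_n) : nat :=
  #|[set i : 'I_n | (i < j) && (key q i == key q j)]|.

Definition slot (j : 'I_n) : nat := 3 * key q j + rank j.

Lemma rank_lt3 j : rank j < 3.
Proof.
apply: leq_trans (bucket_le3 q_spine j); rewrite /rank.
rewrite (cardsD1 j [set i | key q i == key q j]) inE eqxx.
apply: subset_leq_card; apply/subsetP => i; rewrite !inE => /andP[lt_ij ->].
by rewrite andbT; apply: contraTneq lt_ij => ->; rewrite ltnn.
Qed.

Lemma rank_ltn i j : key q i = key q j -> i < j -> rank i < rank j.
Proof.
move=> kij lt_ij; rewrite /rank [X in _ < X](cardsD1 i) inE lt_ij kij eqxx.
rewrite /= add1n ltnS.
apply: subset_leq_card; apply/subsetP => l; rewrite !inE => /andP[lt_li ->].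
rewrite (ltn_trans lt_li lt_ij) !andbT.
by apply: contraTneq lt_li => ->; rewrite ltnn.
Qed.

Lemma slot_inj : injective slot.
Proof.
move=> i j eij; have ri := rank_lt3 i; have rj := rank_lt3 j.
have kij : key q i = key q j by move: eij; rewrite /slot; lia.
have rij : rank i = rank j by move: eij; rewrite /slot kij; lia.
apply/val_inj; case: (ltngtP i j) => // [/(rank_ltn kij)|/(rank_ltn (esym kij))];
  by rewrite rij ltnn.
Qed.

Lemma slot_lt j : slot j < 3 * (size q).+1.
Proof. have := rank_lt3 j; have := key_le q_spine j; rewrite /slot; lia. Qed.

Lemma card_slot_eq_le1 (X : {set 'I_n}) v :
  (forall j, j \in X -> slot j = v) -> #|X| <= 1.
Proof.
by move=> h; apply/card_le1_eqP => i j /h ei /h ej; apply: slot_inj; rewrite ei.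
Qed.

(** The inequality is strict because connectivity exceeds [meet_dim] by one; [meet_slot_le] spends
    this unit. *)
Lemma meet_key_lt (m : nat) (A : 'M[int]_(m, n)) i : 1 < n ->
  meet_dim A [set j | key q j <= i] < width D A.
Proof.
move=> n1; have [cut|ncut] := boolP (0 < i < size q).
  by rewrite -connectivityE; exact: cut_connectivity.
suff : [set j | key q j <= i] = set0 \/ [set j | key q j <= i] = setT.
  have := width_gt0 A n1.
  by move=> w0 [] ->; rewrite -?setC0 ?meet_dimC meet_dim0.
have [le_qi|lt_iq] := leqP (size q) i.
  right; apply/setP => j; rewrite !inE; exact: leq_trans (key_le q_spine j) _.
left; apply/setP => j; rewrite !inE.
have [|u uq [_ ->]] := @keyP q q_spine j; first by lia.
by rewrite /place uq; lia.
Qed.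

Lemma meet_slot_le (m : nat) (A : 'M[int]_(m, n)) i :
  meet_dim A [set j | slot j < i] <= width D A.
Proof.
(* For a single column the width is 0 and there is no unit to spend, but then the set is empty or
   full. *)
have [n1|n1] := leqP n 1.
  suff : [set j | slot j < i] = set0 \/ [set j | slot j < i] = setT.
    by case=> ->; rewrite -?setC0 ?meet_dimC meet_dim0.
  have [->|[j jX]] := set_0Vmem [set j | slot j < i]; [by left | right].
  apply/setP => l; rewrite [RHS]inE; suff -> : l = j by [].
  by apply/val_inj; have := ltn_ord l; have := ltn_ord j; move=> /=; lia.
have slotP j : (slot j < i) =
    (key q j < i %/ 3) || (key q j == i %/ 3) && (rank j < i %% 3).
  by have := rank_lt3 j; rewrite /slot; lia.
(* With [i = 3 k + c], the prefix holds the keys below [k] and, in bucket [k], the ranks below [c].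
   If [c = 2], it lacks at most the column of rank 2 among the keys up to [k]; if [c < 2], it has at
   most the column of rank 0 beyond the keys below [k]. *)
have [c2|c2] := eqVneq (i %% 3) 2.
  have := meet_key_lt A (i %/ 3) n1.
  have [||+ _] := @meet_dim_near m n A [set j | slot j < i] [set j | key q j <= i %/ 3].
  - by apply/subsetP => j; rewrite !inE slotP; lia.
  - apply: (@card_slot_eq_le1 _ i) => j; rewrite !inE slotP.
    by have := rank_lt3 j; rewrite /slot; lia.
  by lia.
have near Y : Y = [set j | key q j < i %/ 3] -> meet_dim A Y < width D A ->
    meet_dim A [set j | slot j < i] <= width D A.
  move=> YE; have [||_] := @meet_dim_near m n A Y [set j | slot j < i]; last by lia.
  - by rewrite YE; apply/subsetP => j; rewrite !inE slotP => ->.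
  - apply: (@card_slot_eq_le1 _ (3 * (i %/ 3))) => j; rewrite YE !inE slotP.
    by have := rank_lt3 j; rewrite /slot; lia.
have [k0|k0] := posnP (i %/ 3).
  apply: (near set0); last by rewrite meet_dim0 width_gt0.
  by apply/setP => j; rewrite !inE k0.
apply: near (erefl _) _; rewrite -(prednK k0).
by under eq_finset do rewrite ltnS; exact: meet_key_lt.
Qed.

End Slots.

End PathDecomposition.

(** * Executions with postconditions *)

Fixpoint written_vars (c : cmd) : seq nat :=
  match c with
  | Assign x _ => [:: x]
  | Seq c1 c2 | If _ c1 c2 => written_vars c1 ++ written_vars c2
  | While _ c1 => written_vars c1
  | _ => [::]
  end.

Fixpoint written_arrs (c : cmd) : seq nat :=
  match c with
  | Store a _ _ => [:: a]
  | Seq c1 c2 | If _ c1 c2 => written_arrs c1 ++ written_arrs c2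
  | While _ c1 => written_arrs c1
  | _ => [::]
  end.

(** The frame condition. The rules below supply it automatically, so that invariants need to mention
    only the cells that change. *)
Definition agree (c : cmd) (s s' : state) : Prop :=
  (forall x, x \notin written_vars c -> var s' x = var s x) /\
  (forall a p, a \notin written_arrs c -> arr s' a p = arr s a p).

Lemma exec_agree c s s' t : exec c s s' t -> agree c s s'.
Proof.
elim=> {c s s' t} /=; try by split.
- move=> x e s v _; split=> //= y.
  by rewrite inE => /negPf ->.
- move=> a e1 e2 s q p v _ _ _; split=> //= a' p'.
  by rewrite inE => /negPf ->.
- move=> c1 c2 s s1 s2 t1 t2 _ [V1 A1] _ [V2 A2]; split=> [x|a p];
    rewrite /= mem_cat negb_or => /andP[h1 h2].
    by rewrite V2 // V1.
  by rewrite A2 // A1.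
- move=> b c1 c2 s s' t _ _ [V1 A1]; split=> [x|a p];
    rewrite /= mem_cat negb_or => /andP[h1 h2]; by [apply: V1 | apply: A1].
- move=> b c1 c2 s s' t _ _ [V1 A1]; split=> [x|a p];
    rewrite /= mem_cat negb_or => /andP[h1 h2]; by [apply: V1 | apply: A1].
- move=> b c s s1 s2 t1 t2 _ _ [V1 A1] _ [V2 A2]; split=> [x|a p] /= h.
    by rewrite V2 // V1.
  by rewrite A2 // A1.
Qed.

(** Total correctness within a time budget. Nesting [run] in a postcondition executes a sequence
    symbolically from left to right. *)
Definition run (c : cmd) (s : state) (T : nat) (Q : state -> Prop) : Prop :=
  exists s' t, [/\ exec c s s' t, (t <= T)%N & Q s'].

Lemma run_conseq c s T T' (Q Q' : state -> Prop) :
  run c s T Q -> (T <= T')%N -> (forall s', agree c s s' -> Q s' -> Q' s') ->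
  run c s T' Q'.
Proof.
move=> [s' [t [E le_tT q]]] le_TT' QQ'; exists s', t; split=> //.
  exact: leq_trans le_TT'.
exact: QQ' (exec_agree E) q.
Qed.

Lemma run_weaken c s T (Q Q' : state -> Prop) :
  run c s T Q -> (forall s', agree c s s' -> Q s' -> Q' s') -> run c s T Q'.
Proof. by move=> /run_conseq h; apply: h. Qed.

Lemma run_le c s T T' Q : run c s T Q -> (T <= T')%N -> run c s T' Q.
Proof. by move=> /run_conseq h /h; apply. Qed.

Lemma run_skip s (Q : state -> Prop) : Q s -> run Skip s 1 Q.
Proof. by move=> q; exists s, 1%N; split=> //; exact: ExecSkip. Qed.

Lemma run_assign x e s v (Q : state -> Prop) :
  eval s e = Some v -> Q (set_var s x v) ->
  run (Assign x e) s (expr_cost e).+1 Q.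
Proof. by move=> ev q; do 2!eexists; split; [exact: ExecAssign ev| |]. Qed.

Lemma address_nat p : address p%:R = Some p.
Proof. by rewrite /address natr_nat natrK. Qed.

Lemma run_store a e1 e2 s p v (Q : state -> Prop) :
  eval s e1 = Some p%:R -> eval s e2 = Some v -> Q (set_arr s a p v) ->
  run (Store a e1 e2) s (expr_cost e1 + expr_cost e2).+1 Q.
Proof.
move=> ev1 ev2 q; do 2!eexists; split; last exact: q; last exact: leqnn.
exact: ExecStore ev1 (address_nat p) ev2.
Qed.

Lemma run_seq c1 c2 s T1 T2 Q :
  run c1 s T1 (fun s1 => run c2 s1 T2 Q) -> run (Seq c1 c2) s (T1 + T2) Q.
Proof.
move=> [s1 [t1 [E1 le1 [s2 [t2 [E2 le2 q]]]]]]; exists s2, (t1 + t2)%N.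
by split=> //; [exact: ExecSeq E1 E2 | exact: leq_add].
Qed.

Lemma run_seq_le T1 T2 c1 c2 s T Q : (T1 + T2 <= T)%N ->
  run c1 s T1 (fun s1 => run c2 s1 T2 Q) -> run (Seq c1 c2) s T Q.
Proof. by move=> le_T /run_seq/run_le; apply. Qed.

Lemma run_if b c1 c2 s v T Q :
  eval_test s b = Some v ->
  (if v then run c1 s T Q else run c2 s T Q) ->
  run (If b c1 c2) s (test_cost b + T).+1 Q.
Proof.
case: v => ev [s' [t [E le_t q]]]; exists s', (test_cost b + t).+1; split=> //;
  first [by rewrite ltnS leq_add2l | exact: ExecIfTrue ev E
        | exact: ExecIfFalse ev E].
Qed.

Definition For (x : nat) (e : expr) (c : cmd) : cmd :=
  Seq (Assign x (Const 0))
    (While (Not (Leq e (Var x))) (Seq c (Assign x (Add (Var x) (Const 1))))).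

Lemma agree_trans c s s1 s2 : agree c s s1 -> agree c s1 s2 -> agree c s s2.
Proof.
move=> [V1 A1] [V2 A2]; split=> [x|a p] h; first by rewrite V2 // V1.
by rewrite A2 // A1.
Qed.

(** The bound [e] is evaluated anew in each round, so its value must survive the body. A successful
    test costs [expr_cost e + 4] and the increment 4, giving the 8; the failing test costs
    [expr_cost e + 4] and the initialisation 2, giving the 6. *)
Lemma run_for_inv x e c s N T (I : nat -> state -> Prop) :
  (forall s', agree (For x e c) s s' -> eval s' e = Some N%:R) ->
  x \notin written_vars c ->
  (forall i s' v, I i s' -> I i (set_var s' x v)) ->
  I 0%N s ->
  (forall i s', (i < N)%N -> agree (For x e c) s s' -> var s' x = i%:R ->
     I i s' -> run c s' T (I i.+1)) ->
  run (For x e c) s (N * (T + expr_cost e + 8) + expr_cost e + 6) (I N).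
Proof.
move=> He xc Iset I0 body.
pose w := While (Not (Leq e (Var x))) (Seq c (Assign x (Add (Var x) (Const 1)))).
have loop j s' : (j <= N)%N -> agree (For x e c) s s' ->
    var s' x = (N - j)%:R -> I (N - j)%N s' ->
    run w s' (j * (T + expr_cost e + 8) + expr_cost e + 4) (I N).
  elim: j s' => [|j IHj] s' le_jN ag Ex Is'.
    exists s', (test_cost (Not (Leq e (Var x)))).+1; split=> //=; last 2 first.
    - lia.
    - by rewrite -[N]subn0.
    by apply: ExecWhileFalse; rewrite /= He //= Ex subn0 lexx.
  have lt_i : (N - j.+1 < N)%N by lia.
  have [s1 [t1 [E1 le1 I1]]] := body _ _ lt_i ag Ex Is'.
  have [V1 A1] := exec_agree E1.
  pose s2 := set_var s1 x (N - j)%:R.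
  have E2 : exec (Assign x (Add (Var x) (Const 1))) s1 s2 4.
    apply: ExecAssign => /=.
    rewrite V1 // Ex; congr Some; rewrite -natrD; congr _%:R; lia.
  have ag2 : agree (For x e c) s s2.
    apply: agree_trans ag _; split=> [y|a p] /=.
      rewrite inE mem_cat negb_or => /andP[/negPf -> /norP[h _]].
      exact: V1.
    by rewrite cats0 => h; exact: A1.
  have [||||s3 [t3 [E3 le3 q]]] := IHj s2 => //; first by lia.
  - by rewrite /= eqxx.
  - have eNj : (N - j = (N - j.+1).+1)%N by lia.
    by rewrite /s2 eNj; exact: Iset.
  exists s3, (test_cost (Not (Leq e (Var x))) + (t1 + 4) + t3).+1; split=> //.
    apply: ExecWhileTrue (ExecSeq E1 E2) E3 => /=.
    by rewrite He //= Ex ler_nat -ltnNge lt_i.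
  by rewrite /=; lia.
have [||||s1 [t1 [E1 le1 q]]] := loop N (set_var s x 0) => //.
- split=> [y|//] /=; rewrite inE => /norP[/negPf -> //].
- by rewrite /= eqxx subnn.
- by rewrite subnn; exact: Iset.
exists s1, (2 + t1)%N; split=> //; last by lia.
by apply: ExecSeq E1; exact: ExecAssign.
Qed.

Lemma run_for (I : nat -> state -> Prop) (T N : nat) x e c s T' Q :
  (forall s', agree (For x e c) s s' -> eval s' e = Some N%:R) ->
  x \notin written_vars c ->
  (forall i s' v, I i s' -> I i (set_var s' x v)) ->
  I 0%N s ->
  (forall i s', (i < N)%N -> agree (For x e c) s s' -> var s' x = i%:R ->
     I i s' -> run c s' T (I i.+1)) ->
  (N * (T + expr_cost e + 8) + expr_cost e + 6 <= T')%N ->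
  (forall s', agree (For x e c) s s' -> I N s' -> Q s') ->
  run (For x e c) s T' Q.
Proof. by move=> h1 h2 h3 h4 h5; apply: run_conseq; exact: run_for_inv. Qed.

Lemma eval_const s (k : nat) : eval s (Const k) = Some k%:R.
Proof. by []. Qed.

Lemma eval_var s x v : var s x = v -> eval s (Var x) = Some v.
Proof. by move=> <-. Qed.

Lemma eval_get s a e p v :
  eval s e = Some p%:R -> arr s a p = v -> eval s (Get a e) = Some v.
Proof. by move=> /= -> <-; rewrite /= address_nat. Qed.

Lemma eval_add s e1 e2 u v : eval s e1 = Some u -> eval s e2 = Some v ->
  eval s (Add e1 e2) = Some (u + v).
Proof. by move=> /= -> ->. Qed.

Lemma eval_addn s e1 e2 (i j : nat) : eval s e1 = Some i%:R ->
  eval s e2 = Some j%:R -> eval s (Add e1 e2) = Some (i + j)%:R.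
Proof. by move=> /= -> -> /=; rewrite natrD. Qed.

Lemma eval_sub s e1 e2 u v : eval s e1 = Some u -> eval s e2 = Some v ->
  eval s (Defs.Sub e1 e2) = Some (u - v).
Proof. by move=> /= -> ->. Qed.

Lemma eval_mul s e1 e2 u v : eval s e1 = Some u -> eval s e2 = Some v ->
  eval s (Mul e1 e2) = Some (u * v).
Proof. by move=> /= -> ->. Qed.

Lemma eval_muln s e1 e2 (i j : nat) : eval s e1 = Some i%:R ->
  eval s e2 = Some j%:R -> eval s (Mul e1 e2) = Some (i * j)%:R.
Proof. by move=> /= -> -> /=; rewrite natrM. Qed.

Lemma eval_div s e1 e2 u v : eval s e1 = Some u -> eval s e2 = Some v ->
  eval s (Div e1 e2) = Some (u / v).
Proof. by move=> /= -> ->. Qed.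

Lemma eval_leq s e1 e2 u v : eval s e1 = Some u -> eval s e2 = Some v ->
  eval_test s (Leq e1 e2) = Some (u <= v).
Proof. by move=> /= -> ->. Qed.

(** * Computing the order *)

Local Notation vm := 0%N.
Local Notation vn := 1%N.
Local Notation vN := 2%N.
Local Notation vE := 3%N.
Local Notation vi := 4%N.
Local Notation vj := 5%N.
Local Notation vr := 6%N.
Local Notation vu := 7%N.
Local Notation vw := 8%N.
Local Notation vcur := 9%N.
Local Notation vprev := 10%N.
Local Notation vT := 11%N.
Local Notation vK := 12%N.
Local Notation vd := 13%N.
Local Notation vacc := 14%N.
Local Notation vnorm := 15%N.
Local Notation vq := 16%N.
Local Notation vlo := 17%N.
Local Notation vlen := 18%N.
Local Notation vcnt := 19%N.
Local Notation vok := 20%N.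
Local Notation vcode := 21%N.
Local Notation vpow := 22%N.
Local Notation vres := 23%N.
Local Notation vval := 24%N.
Local Notation vk := 25%N.
Local Notation vfound := 26%N.

Local Notation aA := 0%N.
Local Notation ab := 1%N.
Local Notation aedge := 2%N.
Local Notation alabel := 3%N.
Local Notation aleaf := 4%N.
Local Notation asum := 5%N.
Local Notation adeg := 6%N.
Local Notation apos := 7%N.
Local Notation acnt := 8%N.
Local Notation acol := 9%N.
Local Notation aM := 10%N.
Local Notation aF := 11%N.
Local Notation aL := 12%N.
Local Notation aseen := 13%N.

Local Notation "x ::= e" := (Assign x e) (at level 60).
Local Notation "a [ e1 ] ::= e2" := (Store a e1 e2) (at level 60, e1 at level 50).
Local Notation "c1 ;;; c2" := (Seq c1 c2) (at level 70, right associativity).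

Ltac lookup := rewrite /=; first [eassumption | reflexivity].
(** The natural-number rules come first: an address has to come out as the image of a natural
    number. *)
Ltac ev := lazymatch goal with
  | |- eval _ (Const _) = _ => exact: eval_const
  | |- eval _ (Var _) = _ => apply: eval_var; lookup
  | |- eval _ (Get _ _) = _ => apply: eval_get; [ev | lookup]
  | |- eval _ (Add _ _) = _ =>
      first [apply: eval_addn; [ev | ev] | apply: eval_add; [ev | ev]]
  | |- eval _ (Mul _ _) = _ =>
      first [apply: eval_muln; [ev | ev] | apply: eval_mul; [ev | ev]]
  | |- eval _ (Defs.Sub _ _) = _ => apply: eval_sub; [ev | ev]
  | |- eval _ (Div _ _) = _ => apply: eval_div; [ev | ev]
  end.
Ltac assign := apply: run_assign; first ev.
Ltac store := apply: run_store; [ev | ev | idtac].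

Lemma sum_ordS (V : nmodType) n (P : pred 'I_n) (F : 'I_n -> V) J (ltJ : (J < n)%N) :
  \sum_(j < n | (j < J.+1)%N && P j) F j = \sum_(j < n | (j < J)%N && P j) F j +
    (if P (Ordinal ltJ) then F (Ordinal ltJ) else 0).
Proof.
rewrite [LHS](bigID (pred1 (Ordinal ltJ))) /= addrC; congr (_ + _).
  apply: eq_bigl => j; rewrite ltnS leq_eqVlt -[(j : nat) == J]/(j == Ordinal ltJ).
  by case: eqVneq => [->|_] /=; rewrite ?ltnn ?andbF ?andbT.
case: ifP => PJ.
  rewrite (big_pred1 (Ordinal ltJ)) // => j /=; case: eqVneq => [->|]; last by rewrite andbF.
  by rewrite leqnn PJ.
by rewrite big1 // => j /andP[/andP[_ Pj] /eqP jJ]; rewrite -jJ Pj in PJ.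
Qed.

Lemma sum_ordT (V : nmodType) n (P : pred 'I_n) (F : 'I_n -> V) :
  \sum_(j < n | (j < n)%N && P j) F j = \sum_(j | P j) F j.
Proof. by apply: eq_bigl => j; rewrite ltn_ord. Qed.

(** Division with remainder by [m]: a store into a row-major array changes a single entry. *)
Lemma index_eq m k k' (r r' : 'I_m) :
  (k * m + r == k' * m + r')%N = (k == k') && (r == r').
Proof.
apply/eqP/andP => [e|[/eqP -> /eqP ->] //].
have m0 : (0 < m)%N := leq_ltn_trans (leq0n r) (ltn_ord r).
move: (congr1 (modn^~ m) e) (congr1 (divn^~ m) e) => /=.
rewrite !modnMDl !modn_small // !divnMDl // !divn_small // !addn0 => /val_inj ->.
by move=> ->; rewrite !eqxx.
Qed.

Section Ordering.
Variables (n : nat) (D : labelled_graph n).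
Local Notation vertex := 'I_(n_vertices D).

(** Leaves are recognised as the values of the labelling, without counting degrees. *)
Definition mark_leaves : cmd :=
  For vi (Var vn) (aleaf[Get alabel (Var vi)] ::= Const 1).

Lemma run_mark_leaves s :
  labels_leaves D -> var s vn = n%:R ->
  (forall j : 'I_n, arr s alabel j = (label D j)%:R) ->
  (forall p, arr s aleaf p = 0) ->
  run mark_leaves s (n * 13 + 7)
    (fun s' => forall v : vertex, arr s' aleaf v = (is_leaf v)%:R).
Proof.
move=> [inj_l leaf_l] En El E0.
apply: (run_for (I := fun J s' => forall v : vertex,
   arr s' aleaf v = [exists j : 'I_n, (j < J)%N && (label D j == v)]%:R)
   (T := 4) (N := n)) => //.
- by move=> s' ag; apply: eval_var; rewrite (ag.1 vn).
- by move=> v; rewrite E0; case: existsP => // -[j]; rewrite ltn0.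
- move=> J s1 lt_J ag Ei Is.
  have El1 : arr s1 alabel J = (label D (Ordinal lt_J))%:R.
    by rewrite (ag.2 alabel J isT) -El.
  store => v /=; rewrite Is (inj_eq val_inj); case: eqVneq => [->|vJ].
    by case: existsP => // -[]; exists (Ordinal lt_J); rewrite /= leqnn eqxx.
  congr (nat_of_bool _)%:R; apply/existsP/existsP => -[j /andP[lt_j lj]]; exists j.
    by rewrite lj andbT ltnW.
  rewrite lj andbT ltn_neqAle -ltnS lt_j andbT; apply: contraNneq vJ => jJ.
  by rewrite -(eqP lj); apply/eqP; congr label; exact: val_inj.
- by rewrite /=; lia.
move=> s' _ Is v; rewrite Is; congr (nat_of_bool _)%:R.
rewrite -leaf_l; apply/existsP/codomP => [[j /andP[_ /eqP <-]]|[j ->]].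
  by exists j.
by exists j; rewrite ltn_ord eqxx.
Qed.

Definition nbr_sum (g : vertex -> nat) (v : vertex) : nat :=
  \sum_(w | adj v w && ~~ is_leaf w) g w.

(** The factor [1 - aleaf[y]] keeps internal neighbours only. For a leaf, [asum] thus becomes the
    spine vertex it hangs from; for a spine vertex, the sum of its neighbours on the spine. *)
Definition tally (x y : nat) : cmd :=
  asum[Var x] ::= Add (Get asum (Var x))
    (Mul (Var y) (Defs.Sub (Const 1) (Get aleaf (Var y)))) ;;;
  adeg[Var x] ::= Add (Get adeg (Var x)) (Defs.Sub (Const 1) (Get aleaf (Var y))).

Lemma run_tally x y s (u w : vertex) :
  var s x = (u : nat)%:R -> var s y = (w : nat)%:R ->
  (forall v : vertex, arr s aleaf v = (is_leaf v)%:R) ->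
  run (tally x y) s 20 (fun s' => forall v : vertex,
    arr s' asum v = arr s asum v + ((u == v) * (~~ is_leaf w * w))%:R /\
    arr s' adeg v = arr s adeg v + ((u == v) * ~~ is_leaf w)%:R).
Proof.
move=> Ex Ey El; have Ew := El w.
apply: (@run_seq _ _ _ 11 9); store; store => v /=.
rewrite (inj_eq val_inj) [v == u]eq_sym; case: eqVneq => [->|_]; last first.
  by rewrite !mul0n !addr0.
by split; congr (_ + _); case: is_leaf; rewrite ?mulr0 ?subrr ?mul1n ?mulr1 ?subr0.
Qed.

Definition sum_neighbours : cmd :=
  For vi (Var vE)
    (vu ::= Get aedge (Mul (Const 2) (Var vi)) ;;;
     vw ::= Get aedge (Add (Mul (Const 2) (Var vi)) (Const 1)) ;;;
     tally vu vw ;;; tally vw vu).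

Lemma run_sum_neighbours s :
  simple_edges D -> var s vE = (size (edges D))%:R ->
  (forall i e, (i < size (edges D))%N ->
     arr s aedge (2 * i) = ((nth e (edges D) i).1 : nat)%:R /\
     arr s aedge (2 * i + 1) = ((nth e (edges D) i).2 : nat)%:R) ->
  (forall v : vertex, arr s aleaf v = (is_leaf v)%:R) ->
  (forall p, arr s asum p = 0) -> (forall p, arr s adeg p = 0) ->
  run sum_neighbours s (size (edges D) * 61 + 7) (fun s' => forall v : vertex,
    arr s' asum v = (nbr_sum (@nat_of_ord _) v)%:R /\
    arr s' adeg v = (nbr_sum (fun=> 1%N) v)%:R).
Proof.
move=> simp EE Ee El Es Ed.
pose part (g : vertex -> nat) es v :=
  (\sum_(e <- es) ((e.1 == v) * (~~ is_leaf e.2 * g e.2) +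
                   (e.2 == v) * (~~ is_leaf e.1 * g e.1)))%N.
have partE g v : part g (edges D) v = nbr_sum g v.
  rewrite /part (sum_edges simp (fun w => ~~ is_leaf w * g w)%N) /nbr_sum big_mkcondr.
  by apply: eq_bigr => w _; case: is_leaf; rewrite ?mul1n.
have part_rcons g es e v : part g (rcons es e) v =
    (part g es v + ((e.1 == v) * (~~ is_leaf e.2 * g e.2) +
                    (e.2 == v) * (~~ is_leaf e.1 * g e.1)))%N.
  by rewrite /part -cats1 big_cat big_seq1.
apply: (run_for (I := fun i s' => forall v : vertex,
    arr s' asum v = (part (@nat_of_ord _) (take i (edges D)) v)%:R /\
    arr s' adeg v = (part (fun=> 1%N) (take i (edges D)) v)%:R)
   (T := 52) (N := size (edges D))) => //.
- by move=> s' ag; apply: eval_var; rewrite (ag.1 vE).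
- by move=> v; rewrite take0 Es Ed /part !big_nil.
- move=> i s1 lt_i ag Ei Is.
  have [e0 _] : exists e0 : vertex * vertex, true.
    by case: (edges D) lt_i => // e; exists e.
  set e := nth e0 (edges D) i.
  have Ee1 : arr s1 aedge (2 * i) = (e.1 : nat)%:R.
    by rewrite (ag.2 aedge _ isT); case: (Ee i e0 lt_i).
  have Ee2 : arr s1 aedge (2 * i + 1) = (e.2 : nat)%:R.
    by rewrite (ag.2 aedge _ isT); case: (Ee i e0 lt_i).
  apply: (@run_seq _ _ _ 5); assign.
  apply: (@run_seq _ _ _ 7); assign.
  set s2 := set_var _ _ _.
  have El2 (v : vertex) : arr s2 aleaf v = (is_leaf v)%:R.
    by rewrite /= (ag.2 aleaf _ isT).
  apply: (@run_seq _ _ _ 20 20); apply: run_weaken (run_tally _ _ El2) _ => // s3 ag3 I3.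
  have El3 (v : vertex) : arr s3 aleaf v = (is_leaf v)%:R.
    by rewrite (ag3.2 aleaf _ isT).
  apply: run_weaken (run_tally (u := e.2) (w := e.1) _ _ El3) _.
  - by rewrite (ag3.1 vw isT).
  - by rewrite (ag3.1 vu isT).
  move=> s4 ag4 I4 v; case: (I4 v) (I3 v) (Is v) => -> -> [-> ->] /= [-> ->].
  by rewrite (take_nth e0 lt_i) !part_rcons -/e !natrD !addrA !muln1.
- by rewrite /=; lia.
by move=> s' _ Is v; case: (Is v); rewrite take_size !partE.
Qed.

(* The test means: internal, with at most one internal neighbour. *)
Definition find_end : cmd :=
  For vi (Var vN)
    (If (Leq (Add (Mul (Const 2) (Get aleaf (Var vi))) (Get adeg (Var vi))) (Const 1))
       (vcur ::= Var vi) Skip).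

Definition spine_end (v : vertex) : bool :=
  ~~ is_leaf v && (nbr_sum (fun=> 1%N) v <= 1)%N.

Lemma run_find_end s :
  var s vN = (n_vertices D)%:R ->
  (forall v : vertex, arr s aleaf v = (is_leaf v)%:R) ->
  (forall v : vertex, arr s adeg v = (nbr_sum (fun=> 1%N) v)%:R) ->
  run find_end s (n_vertices D * 21 + 7) (fun s' =>
    forall v0, spine_end v0 -> exists2 v, spine_end v & var s' vcur = (v : nat)%:R).
Proof.
move=> EN El Ed.
apply: (run_for (I := fun i s' =>
    (exists2 v, spine_end v & var s' vcur = (v : nat)%:R) \/
    (forall v : vertex, (v < i)%N -> ~~ spine_end v))
   (T := 12) (N := n_vertices D)) => //.
- by move=> s' ag; apply: eval_var; rewrite (ag.1 vN).
- by right.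
- move=> i s1 lt_i ag Ei Is; pose v := Ordinal lt_i.
  have El1 : arr s1 aleaf i = (is_leaf v)%:R by rewrite (ag.2 aleaf _ isT) (El v).
  have Ed1 : arr s1 adeg i = (nbr_sum (fun=> 1%N) v)%:R.
    by rewrite (ag.2 adeg _ isT) (Ed v).
  apply: (@run_if _ _ _ _ _ 2); first by apply: eval_leq; ev.
  have -> : ((2 * is_leaf v + nbr_sum (fun=> 1%N) v)%:R <= 1%:R :> rat) = spine_end v.
    by rewrite ler_nat /spine_end; case: is_leaf.
  case: ifP => [end_v|/negbT nend].
    by assign; left; exists v.
  apply: run_le (run_skip _) _ => //; case: Is => [|lt_end]; [by left | right=> u].
  rewrite ltnS leq_eqVlt => /orP[/eqP ui|]; last exact: lt_end.
  by rewrite (_ : u = v) //; exact: val_inj.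
- by rewrite /=; lia.
by move=> s' _ [//|no_end] v0 end0; have := no_end v0 (ltn_ord _); rewrite end0.
Qed.

(* [asum] holds the sum of the internal neighbours of each vertex, so the next
   vertex of the spine is this sum minus the previous vertex. *)
Definition walk : cmd :=
  vT ::= Defs.Sub (Var vN) (Var vn) ;;;
  For vi (Var vT)
    (apos[Var vcur] ::= Add (Var vi) (Const 1) ;;;
     vu ::= Defs.Sub (Get asum (Var vcur)) (Var vprev) ;;;
     vprev ::= Var vcur ;;;
     vcur ::= Var vu).

Lemma run_walk s q v0 :
  is_spine q -> var s vN = (n + size q)%:R -> var s vn = n%:R -> var s vprev = 0 ->
  (forall p, arr s apos p = 0) ->
  (forall v : vertex, arr s asum v = (nbr_sum (@nat_of_ord _) v)%:R) ->
  ((0 < size q)%N -> var s vcur = (nth v0 q 0 : nat)%:R) ->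
  run walk s (size q * 23 + 11) (fun s' =>
    var s' vT = (size q)%:R /\
    forall v : vertex, arr s' apos v = (place q v)%:R).
Proof.
move=> qS EN En Ep E0 Es Ec; have [uq mq _] := qS.
apply: (@run_seq_le 4 (size q * 23 + 7)); [by lia | assign].
have -> : (n + size q)%:R - n%:R = (size q)%:R :> rat.
  by rewrite natrD addrAC subrr add0r.
set s1 := set_var _ _ _.
(* The first vertex has no predecessor, and the initial value 0 of [vprev] stands for the missing
   term of [spine_sum]. After the last vertex nothing is claimed about [vcur]. *)
apply: (run_for (I := fun i s' => [/\
    forall v : vertex, arr s' apos v = (if (index v q < i)%N then place q v else 0)%:R,
    (i < size q)%N -> var s' vcur = (nth v0 q i : nat)%:R &
    var s' vprev = (if i is i'.+1 then nth v0 q i' : nat else 0)%:R])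
   (T := 14) (N := size q)) => //.
- by move=> s' ag; apply: eval_var; rewrite (ag.1 vT).
- by split=> // v; rewrite /= E0.
- move=> i s2 lt_i ag Ei [Epos /(_ lt_i) Ecur Eprev].
  set v := nth v0 q i in Ecur.
  have Esum : arr s2 asum v = (nbr_sum (@nat_of_ord _) v)%:R.
    by rewrite (ag.2 asum _ isT) Es.
  apply: (@run_seq _ _ _ 5); store.
  apply: (@run_seq _ _ _ 5); assign.
  apply: (@run_seq _ _ _ 2 2); assign; assign; split=> /=.
  - move=> w; rewrite (inj_eq val_inj) Epos; case: eqVneq => [->|wv].
      by rewrite /v /place mem_nth // index_uniq // ltnS leqnn addn1.
    have wi : index w q != i.
      by apply: contraNneq wv => wi; rewrite /v -wi nth_index // -index_mem wi.
    by have -> : (index w q < i.+1)%N = (index w q < i)%N by lia.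
  - move=> lt_i1; rewrite /nbr_sum (spine_sum qS) // lt_i1 natrD.
    by case: (i) => [|i'] /=; rewrite ?add0r ?subr0 // addrAC subrr add0r.
  by [].
- by rewrite /=; lia.
move=> s2 ag2 [Epos _ _]; split; first by rewrite (ag2.1 vT).
move=> v; rewrite Epos; case: ifP => //; rewrite index_mem => /negbT vq.
by rewrite /place (negPf vq).
Qed.

(** A bucket sort: the number of columns already met with this key is the [rank] of the current
    one. *)
Definition arrange : cmd :=
  For vi (Var vn)
    (vq ::= Get apos (Get asum (Get alabel (Var vi))) ;;;
     vk ::= Add (Mul (Const 3) (Var vq)) (Get acnt (Var vq)) ;;;
     acnt[Var vq] ::= Add (Get acnt (Var vq)) (Const 1) ;;;
     For vj (Var vm)
       (acol[Add (Mul (Var vk) (Var vm)) (Var vj)] ::=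
          Add (Get acol (Add (Mul (Var vk) (Var vm)) (Var vj)))
            (Get aA (Add (Mul (Var vj) (Var vn)) (Var vi))))).

(** At most one term by [slot_inj]; as a sum it also covers the empty slots, with the zero
    column. *)
Definition slot_col m (A : 'M[int]_(m, n)) (q : seq vertex) k : 'cV[int]_m :=
  \sum_(j | slot q j == k) col j A.

Lemma run_arrange m (A : 'M[int]_(m, n)) s q :
  (0 < m)%N -> var s vm = m%:R -> var s vn = n%:R ->
  (forall (i : 'I_m) (j : 'I_n), arr s aA (i * n + j) = (A i j)%:~R) ->
  (forall j : 'I_n, arr s alabel j = (label D j : nat)%:R) ->
  (forall v : vertex, arr s asum v = (nbr_sum (@nat_of_ord _) v)%:R) ->
  (forall v : vertex, arr s apos v = (place q v)%:R) ->
  (forall j : 'I_n, exists2 u : vertex,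
     nbr_sum (@nat_of_ord _) (label D j) = u & key q j = place q u) ->
  (forall p, arr s acnt p = 0) -> (forall p, arr s acol p = 0) ->
  run arrange s (n * (m * 70) + 7) (fun s' =>
    forall k (r : 'I_m), arr s' acol (k * m + r) = (slot_col A q k r 0)%:~R).
Proof.
move=> m0 Em En EA El Es Ep Ek E0 C0.
apply: (run_for (I := fun J s' =>
    (forall k, arr s' acnt k = (\sum_(j < n | (j < J)%N && (key q j == k)) 1)%:R) /\
    (forall k (r : 'I_m), arr s' acol (k * m + r) =
       (\sum_(j < n | (j < J)%N && (slot q j == k)) A r j)%:~R))
   (T := (m * 28 + 33)%N) (N := n)) => //.
- by move=> s' ag; apply: eval_var; rewrite (ag.1 vn).
- by split=> [k|k r]; rewrite ?E0 ?C0 big1.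
- move=> J s1 lt_J ag Ei [Ecnt Ecol]; pose j := Ordinal lt_J.
  have [u u_sum u_place] := Ek j.
  have El1 : arr s1 alabel J = (label D j : nat)%:R by rewrite (ag.2 alabel _ isT) (El j).
  have Es1 : arr s1 asum (label D j) = (u : nat)%:R.
    by rewrite (ag.2 asum _ isT) Es u_sum.
  have Ep1 : arr s1 apos u = (key q j)%:R by rewrite (ag.2 apos _ isT) Ep u_place.
  have Ecnt1 : arr s1 acnt (key q j) = (rank q j)%:R.
    by rewrite Ecnt /rank sum1dep_card.
  apply: (@run_seq_le 5 (m * 28 + 28)); [by lia | assign].
  apply: (@run_seq_le 7 (m * 28 + 21)); [by lia | assign].
  apply: (@run_seq_le 6 (m * 28 + 15)); [by lia | store].
  set s2 := set_arr _ _ _ _.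
  apply: (run_for (I := fun i s' => forall k (r : 'I_m), arr s' acol (k * m + r) =
      arr s1 acol (k * m + r) + (if (k == slot q j) && (r < i)%N then (A r j)%:~R else 0))
     (T := 19) (N := m)) => //.
  + by move=> s' ag2; apply: eval_var; rewrite (ag2.1 vm) //= (ag.1 vm).
  + by move=> k r; rewrite andbF addr0.
  + move=> i s3 lt_i ag3 Ej E3; pose r := Ordinal lt_i.
    have Em3 : var s3 vm = m%:R by rewrite (ag3.1 vm isT) /= (ag.1 vm).
    have En3 : var s3 vn = n%:R by rewrite (ag3.1 vn isT) /= (ag.1 vn).
    have Ei3 : var s3 vi = J%:R by rewrite (ag3.1 vi isT).
    have Ek3 : var s3 vk = (slot q j)%:R by rewrite (ag3.1 vk isT).
    have EA3 : arr s3 aA (i * n + J) = (A r j)%:~R.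
      by rewrite (ag3.2 aA _ isT) /= (ag.2 aA _ isT) (EA r j).
    have := E3 (slot q j) r; rewrite /= ltnn andbF addr0 => Ec3.
    store => k r' /=; rewrite -[i]/(nat_of_ord r) index_eq E3.
    have [->|kn] := eqVneq k (slot q j) => //=.
    have [->|rn] := eqVneq r' r; first by rewrite /= ltnS leqnn.
    have {}rn : (r' : nat) != i := rn.
    by have -> : (r' < i.+1)%N = (r' < i)%N by lia.
  + by rewrite /=; lia.
  move=> s3 ag3 E3; split=> [k|k r].
    rewrite (ag3.2 acnt _ isT) /= (sum_ordS _ _ lt_J) -/j Ecnt.
    rewrite [key q j == k]eq_sym; case: (k =P key q j) => [->|_]; last by rewrite addr0.
    by rewrite /rank -sum1dep_card.
  rewrite E3 Ecol (sum_ordS _ _ lt_J) -/j ltn_ord andbT eq_sym.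
  by case: eqVneq => _; rewrite ?addr0 // rmorphD.
- by rewrite /=; nia.
move=> s' _ [_ Ecol] k r; rewrite Ecol (sum_ordT (fun j => slot q j == k)).
by congr _%:~R; rewrite /slot_col summxE; apply: eq_bigr => j _; rewrite mxE.
Qed.

End Ordering.

Lemma sum_ltS (V : nmodType) n (F : 'I_n -> V) J (ltJ : (J < n)%N) :
  \sum_(j < n | (j < J.+1)%N) F j = \sum_(j < n | (j < J)%N) F j + F (Ordinal ltJ).
Proof.
have h i : \sum_(j < n | (j < i)%N) F j = \sum_(j < n | (j < i)%N && xpredT j) F j.
  by apply: eq_bigl => j; rewrite andbT.
by rewrite !h (sum_ordS xpredT).
Qed.

Lemma sum_ltT (V : nmodType) n (F : 'I_n -> V) :
  \sum_(j < n | (j < n)%N) F j = \sum_j F j.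
Proof. by apply: eq_bigl => j; rewrite ltn_ord. Qed.

Lemma sum_lt0 (V : nmodType) n (F : 'I_n -> V) : \sum_(j < n | (j < 0)%N) F j = 0.
Proof. by rewrite big1. Qed.

Lemma forall_ltS n (P : pred 'I_n) J (ltJ : (J < n)%N) :
  [forall j : 'I_n, (j < J.+1)%N ==> P j] =
  [forall j : 'I_n, (j < J)%N ==> P j] && P (Ordinal ltJ).
Proof.
apply/forallP/andP => [h|[/forallP h Pj] j].
  split; last by have := h (Ordinal ltJ); rewrite leqnn.
  by apply/forallP => j; apply/implyP => lt_j; have := h j; rewrite ltnS ltnW.
rewrite ltnS leq_eqVlt; apply/implyP => /orP[/eqP jJ|]; last exact/implyP.
by have -> : j = Ordinal ltJ by exact: val_inj.
Qed.

Lemma forall_ltT n (P : pred 'I_n) :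
  [forall j : 'I_n, (j < n)%N ==> P j] = [forall j, P j].
Proof. by apply: eq_forallb => j; rewrite ltn_ord. Qed.

Lemma forall_lt0 n (P : pred 'I_n) : [forall j : 'I_n, (j < 0)%N ==> P j].
Proof. by apply/forallP. Qed.

Lemma eval_and s t1 t2 b1 b2 : eval_test s t1 = Some b1 ->
  eval_test s t2 = Some b2 -> eval_test s (And t1 t2) = Some (b1 && b2).
Proof. by move=> /= -> ->. Qed.

(** * Machine code for the bound [d] and the backward sweep *)

Section Solver.
Variable m : nat.

Definition compute_max : cmd :=
  For vi (Var vm)
    (If (Leq (Get ab (Var vi)) (Var vd)) Skip (vd ::= Get ab (Var vi))).

Lemma run_compute_max (b : 'cV[int]_m) s :
  var s vm = m%:R -> var s vd = 0 ->
  (forall r : 'I_m, arr s ab r = (b r 0)%:~R) ->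
  run compute_max s (m * 17 + 7) (fun s' => var s' vd = (max_entry b)%:R).
Proof.
move=> Em Ed Eb.
apply: (run_for (I := fun i s' => exists2 z : int, var s' vd = z%:~R &
    [/\ 0 <= z, forall r : 'I_m, (r < i)%N -> b r 0 <= z
      & z = 0 \/ exists r, z = b r 0])
   (T := 8) (N := m)) => //.
- by move=> s' ag; apply: eval_var; rewrite (ag.1 vm).
- by exists 0 => //; split=> //; left.
- move=> i s1 lt_i ag Ei [z Ez [z0 zmax zb]]; pose r := Ordinal lt_i.
  have Eb1 : arr s1 ab i = (b r 0)%:~R by rewrite (ag.2 ab _ isT) (Eb r).
  have step z' : b r 0 <= z' -> z <= z' -> forall r' : 'I_m, (r' < i.+1)%N -> b r' 0 <= z'.
    move=> bz zz r'; rewrite ltnS leq_eqVlt => /orP[/eqP r'i|/zmax/le_trans]; last exact.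
    by have -> : r' = r by exact: val_inj.
  apply: (@run_if _ _ _ _ _ 3); first by apply: eval_leq; ev.
  rewrite ler_int; case: (leP (b r 0) z) => [le_bz|/ltW le_zb].
    by apply: run_le (run_skip _) _ => //; exists z => //; split=> //; exact: step.
  assign; exists (b r 0) => //; split; first exact: le_trans le_zb.
    exact: step.
  by right; exists r.
- by rewrite /=; lia.
move=> s' _ [z -> [z0 zmax zb]]; rewrite /max_entry.
suff -> : \big[Num.max/0]_(i < m) b i ord0 = z by rewrite pmulrn gez0_abs.
apply/le_anti/andP; split.
  by apply: bigmax_le => // r _; exact: zmax.
by case: zb => [->|[r ->]]; [exact: bigmax_ge_id | exact: (le_bigmax _ (fun i => b i ord0))].
Qed.

Variables (C : nat -> 'cV[int]_m) (K : nat).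

Definition init_sweep : cmd :=
  For vi (Var vm) (aM[Add (Mul (Var vi) (Var vm)) (Var vi)] ::= Const 1).

Lemma run_init_sweep s :
  var s vm = m%:R -> (forall p, arr s aM p = 0) ->
  run init_sweep s (m * 16 + 7) (fun s' =>
    forall r t : 'I_m, arr s' aM (r * m + t) = (1%:M : 'M[rat]_m) r t).
Proof.
move=> Em E0.
apply: (run_for (I := fun i s' => forall r t : 'I_m,
    arr s' aM (r * m + t) = ((r < i)%N && (r == t))%:R) (T := 7) (N := m)) => //.
- by move=> s' ag; apply: eval_var; rewrite (ag.1 vm).
- move=> i s1 lt_i ag Ei Is; have Em1 : var s1 vm = m%:R by rewrite (ag.1 vm).
  pose u := Ordinal lt_i; store => r t /=.
  rewrite -[(i * m + i)%N]/(i * m + u)%N index_eq -[(r : nat) == i]/(r == u) Is.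
  have [->|ru] := eqVneq r u; first by rewrite leqnn ltnn /= eq_sym; case: (_ == _).
  have {}ru : (r : nat) != i := ru.
  by have -> : (r < i.+1)%N = (r < i)%N by lia.
- by rewrite /=; lia.
by move=> s' _ Is r t; rewrite Is ltn_ord mxE.
Qed.

(** The projected column has two uses: it is the functional kept for the search, and the direction
    of the rank-one update that follows. *)
Definition project : cmd :=
  For vj (Var vm)
    (vacc ::= Const 0 ;;;
     For vr (Var vm)
       (vacc ::= Add (Var vacc)
          (Mul (Get aM (Add (Mul (Var vj) (Var vm)) (Var vr)))
               (Get acol (Add (Mul (Var vq) (Var vm)) (Var vr))))) ;;;
     aF[Add (Mul (Var vq) (Var vm)) (Var vj)] ::= Var vacc ;;;
     vnorm ::= Add (Var vnorm) (Mul (Var vacc) (Var vacc))).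

Lemma run_project (M : 'M[rat]_m) (c : 'cV[int]_m) q s :
  var s vm = m%:R -> var s vq = q%:R -> var s vnorm = 0 ->
  (forall r t : 'I_m, arr s aM (r * m + t) = M r t) ->
  (forall r : 'I_m, arr s acol (q * m + r) = (c r 0)%:~R) ->
  let v := M *m ratv c in
  run project s (m * (m * 70) + 7) (fun s' =>
    [/\ var s' vnorm = (v^T *m v) 0 0,
        forall r : 'I_m, arr s' aF (q * m + r) = v r 0
      & forall k (r : 'I_m), k != q -> arr s' aF (k * m + r) = arr s aF (k * m + r)]).
Proof.
move=> Em Eq En EM Ec v.
apply: (run_for (I := fun i s' =>
    [/\ var s' vnorm = \sum_(r < m | (r < i)%N) v r 0 * v r 0,
        forall r : 'I_m, (r < i)%N -> arr s' aF (q * m + r) = v r 0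
      & forall k (r : 'I_m), k != q -> arr s' aF (k * m + r) = arr s aF (k * m + r)])
   (T := (m * 25 + 23)%N) (N := m)) => //.
- by move=> s' ag; apply: eval_var; rewrite (ag.1 vm).
- by rewrite sum_lt0; split.
- move=> i s1 lt_i ag Ei [In If Ik]; pose r := Ordinal lt_i.
  have Em1 : var s1 vm = m%:R by rewrite (ag.1 vm).
  have Eq1 : var s1 vq = q%:R by rewrite (ag.1 vq).
  apply: run_le; [apply: run_seq; assign | idtac].
  apply: run_seq; apply: (run_for (I := fun t s' =>
      var s' vacc = \sum_(u < m | (u < t)%N) M r u * (c u 0)%:~R)
    (T := 16) (N := m) _ _ _ _ _ (leqnn _)) => //.
  + by move=> s' ag2; apply: eval_var; rewrite (ag2.1 vm).
  + by rewrite sum_lt0.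
  + move=> t s2 lt_t ag2 Et Ia; pose u := Ordinal lt_t.
    have Em2 : var s2 vm = m%:R by rewrite (ag2.1 vm).
    have Eq2 : var s2 vq = q%:R by rewrite (ag2.1 vq).
    have Ej2 : var s2 vj = i%:R by rewrite (ag2.1 vj).
    have EM2 : arr s2 aM (i * m + t) = M r u.
      by rewrite (ag2.2 aM _ isT) /= (ag.2 aM _ isT) (EM r u).
    have Ec2 : arr s2 acol (q * m + t) = (c u 0)%:~R.
      by rewrite (ag2.2 acol _ isT) /= (ag.2 acol _ isT) (Ec u).
    by assign; rewrite /= (sum_ltS _ lt_t).
  move=> s2 ag2 /=; have -> : \sum_(u < m | (u < m)%N) M r u * (c u 0)%:~R = v r 0.
    by rewrite sum_ltT mxE; apply: eq_bigr => u _; rewrite !mxE.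
  move=> Ea.
  have Em2 : var s2 vm = m%:R by rewrite (ag2.1 vm).
  have Eq2 : var s2 vq = q%:R by rewrite (ag2.1 vq).
  have Ej2 : var s2 vj = i%:R by rewrite (ag2.1 vj).
  have En2 : var s2 vnorm = \sum_(r < m | (r < i)%N) v r 0 * v r 0.
    by rewrite (ag2.1 vnorm).
  apply: run_seq; store; assign; split=> /=.
  + by rewrite (sum_ltS _ lt_i).
  + move=> u; rewrite -[i]/(nat_of_ord r) index_eq eqxx /=.
    have [-> //|ur] := eqVneq u r; have {}ur : (u : nat) != i := ur.
    by move=> lt_u; rewrite (ag2.2 aF _ isT) /= If //; lia.
  + move=> k u kq; rewrite -[i]/(nat_of_ord r) index_eq (negPf kq) /=.
    by rewrite (ag2.2 aF _ isT) /= Ik.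
  by rewrite /=; lia.
- by rewrite /=; have [->|m0] := posnP m; nia.
move=> s' _ [En' EF Ek]; split=> //; last by move=> r; exact: EF.
by rewrite En' sum_ltT [RHS]mxE; apply: eq_bigr => r _; rewrite [v^T _ _]mxE.
Qed.

(** When the norm is 0, the convention of the machine for division by 0 agrees with the one
    [proj_step] relies on. *)
Definition update : cmd :=
  For vj (Var vm) (For vr (Var vm)
    (aM[Add (Mul (Var vj) (Var vm)) (Var vr)] ::=
       Defs.Sub (Get aM (Add (Mul (Var vj) (Var vm)) (Var vr)))
         (Div (Mul (Get aF (Add (Mul (Var vq) (Var vm)) (Var vj)))
                   (Get aF (Add (Mul (Var vq) (Var vm)) (Var vr))))
              (Var vnorm)))).

Lemma run_update (M : 'M[rat]_m) (v : 'cV[rat]_m) x q s :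
  var s vm = m%:R -> var s vq = q%:R -> var s vnorm = x ->
  (forall r t : 'I_m, arr s aM (r * m + t) = M r t) ->
  (forall r : 'I_m, arr s aF (q * m + r) = v r 0) ->
  run update s (m * (m * 60) + 7) (fun s' =>
    forall r t : 'I_m, arr s' aM (r * m + t) = M r t - v r 0 * v t 0 / x).
Proof.
move=> Em Eq En EM EF.
pose M' r t := M r t - v r 0 * v t 0 / x.
apply: (run_for (I := fun i s' => forall r t : 'I_m,
     arr s' aM (r * m + t) = if (r < i)%N then M' r t else M r t)
   (T := (m * 37 + 7)%N) (N := m)) => //.
- by move=> s' ag; apply: eval_var; rewrite (ag.1 vm).
- move=> i s1 lt_i ag Ei IM; pose r0 := Ordinal lt_i.
  apply: (run_for (I := fun k s' => forall r t : 'I_m, arr s' aM (r * m + t) =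
       if (r < i)%N || (r == r0) && (t < k)%N then M' r t else M r t)
     (T := 28) (N := m)) => //.
  + by move=> s' ag2; apply: eval_var; rewrite (ag2.1 vm) // (ag.1 vm).
  + by move=> r t; rewrite andbF orbF IM.
  + move=> k s2 lt_k ag2 Ek IM2; pose t0 := Ordinal lt_k.
    have Em2 : var s2 vm = m%:R by rewrite (ag2.1 vm isT) (ag.1 vm).
    have Eq2 : var s2 vq = q%:R by rewrite (ag2.1 vq isT) (ag.1 vq).
    have En2 : var s2 vnorm = x by rewrite (ag2.1 vnorm isT) (ag.1 vnorm).
    have Ej2 : var s2 vj = i%:R by rewrite (ag2.1 vj isT).
    have EM2 : arr s2 aM (i * m + k) = M r0 t0.
      by rewrite (IM2 r0 t0) /= !ltnn andbF.
    have EFi : arr s2 aF (q * m + i) = v r0 0.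
      by rewrite (ag2.2 aF _ isT) (ag.2 aF _ isT) (EF r0).
    have EFk : arr s2 aF (q * m + k) = v t0 0.
      by rewrite (ag2.2 aF _ isT) (ag.2 aF _ isT) (EF t0).
    store => r t /=; rewrite -[k]/(nat_of_ord t0) index_eq IM2.
    rewrite -[(r : nat) == i]/(r == r0).
    have [->|rr] := eqVneq r r0; rewrite /= ?orbF // ltnn /=.
    have [->|tt] := eqVneq t t0; first by rewrite /= ltnS leqnn.
    have {}tt : (t : nat) != k := tt.
    by have -> : (t < k.+1)%N = (t < k)%N by lia.
  + by rewrite /=; lia.
  move=> s2 ag2 IM2 r t; rewrite IM2 ltn_ord andbT.
  by have -> : (r < i.+1)%N = (r < i)%N || (r == r0) by rewrite ltnS leq_eqVlt orbC.
- by rewrite /=; have [->|m0] := posnP m; nia.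
by move=> s' _ IM r t; rewrite IM ltn_ord.
Qed.

Definition sweep_columns : cmd :=
  For vi (Var vK)
    (vq ::= Defs.Sub (Defs.Sub (Var vK) (Const 1)) (Var vi) ;;;
     vnorm ::= Const 0 ;;; project ;;; update).

Lemma run_sweep_columns s :
  (0 < m)%N -> var s vm = m%:R -> var s vK = K%:R ->
  (forall r t : 'I_m, arr s aM (r * m + t) = (1%:M : 'M[rat]_m) r t) ->
  (forall k (r : 'I_m), arr s acol (k * m + r) = (C k r 0)%:~R) ->
  run sweep_columns s (K * (m * (m * 170)) + 7) (fun s' =>
    forall k (r : 'I_m), (k < K)%N -> arr s' aF (k * m + r) = functional C K k r 0).
Proof.
move=> m0 Em EK EM Ec.
apply: (run_for (I := fun t s' =>
    (forall r u : 'I_m, arr s' aM (r * m + u) = sweep C K t r u) /\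
    (forall k (r : 'I_m), (K - t <= k < K)%N ->
       arr s' aF (k * m + r) = functional C K k r 0))
   (T := (m * (m * 130) + 22)%N) (N := K)) => //.
- by move=> s' ag; apply: eval_var; rewrite (ag.1 vK).
- by split=> // k r; lia.
- move=> t s1 lt_t ag Et [IM IF].
  have EK1 : var s1 vK = K%:R by rewrite (ag.1 vK).
  have Em1 : var s1 vm = m%:R by rewrite (ag.1 vm).
  apply: run_le; [apply: run_seq; assign | idtac].
  have -> : K%:R - 1%:R - t%:R = (K - t.+1)%:R :> rat.
    by rewrite natrB // -addn1 natrD; ring.
  set q := (K - t.+1)%N; have Kq : (K - q.+1)%N = t by rewrite /q; lia.
  have lt_qK : (q < K)%N by rewrite /q; lia.
  apply: run_seq; assign; apply: run_seq.
  apply: run_weaken (@run_project (sweep C K t) (C q) q _ _ _ _ _ _) _ => //.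
    by move=> r; rewrite /= (ag.2 acol _ isT) Ec.
  rewrite -[sweep C K t]/(sweep C K t); move=> s2 ag2.
  have -> : sweep C K t *m ratv (C q) = functional C K q by rewrite /functional Kq.
  move=> [En2 EF2 Ek2].
  apply: run_weaken (@run_update (sweep C K t) (functional C K q) _ q _ _ _ En2 _ EF2) _.
  + by rewrite (ag2.1 vm isT).
  + by rewrite (ag2.1 vq isT).
  + by move=> r u; rewrite (ag2.2 aM _ isT) /= IM.
  move=> s3 ag3 EM3; split=> [r u|k r /andP[le_qk lt_kK]].
    rewrite EM3 /= /proj_step -/q; have -> : sweep C K t *m ratv (C q) = functional C K q.
      by rewrite /functional Kq.
    rewrite [in RHS]mxE [in RHS]mxE [in RHS]mxE; congr (_ - _).
    by rewrite mulrC; congr (_ * _); rewrite [RHS]mxE big_ord1 [_^T _ _]mxE.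
  rewrite (ag3.2 aF _ isT); have [->|kq] := eqVneq k q; first exact: EF2.
  by rewrite Ek2 //= IF //; move: kq; rewrite /q; lia.
  by rewrite /=; lia.
- have le_m : (m * (m * 130) + 31 <= m * (m * 170))%N by nia.
  by have := leq_mul (leqnn K) le_m; rewrite /=; lia.
by move=> s' _ [_ IF] k r lt_k; apply: IF; lia.
Qed.

End Solver.

(** * The search *)

Section Search.
Variables (m d : nat) (b : 'cV[int]_m).

Definition boxed (z : 'cV[int]_m) : bool := [forall r, 0 <= z r 0 <= d%:Z].

(* Visited vectors are recorded in [aseen], addressed by their digits in base
   [d + 1]. *)
Definition code (z : 'cV[int]_m) : nat :=
  (\sum_(r < m) absz (z r 0%R) * (d + 1) ^ r)%N.

Definition partial_code (z : 'cV[int]_m) (i : nat) : nat :=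
  (\sum_(r < m | r < i) absz (z r 0%R) * (d + 1) ^ r)%N.

Lemma partial_code0 z : partial_code z 0 = 0%N.
Proof. exact: (sum_lt0 (V := nat)). Qed.

Lemma partial_codeS z i (lt_i : (i < m)%N) : partial_code z i.+1 =
  (partial_code z i + absz (z (Ordinal lt_i) 0%R) * (d + 1) ^ i)%N.
Proof. exact: (sum_ltS (V := nat)). Qed.

Lemma partial_codeT z : partial_code z m = code z.
Proof. exact: (sum_ltT (V := nat)). Qed.

(** Uniqueness of base [B] digits: the lowest is the remainder modulo [B], and the quotient
    determines the others. *)
Lemma digits_inj B n (x y : nat -> nat) :
  (forall r, (r < n)%N -> (x r < B)%N) -> (forall r, (r < n)%N -> (y r < B)%N) ->
  (\sum_(r < n) x r * B ^ r = \sum_(r < n) y r * B ^ r)%N ->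
  forall r, (r < n)%N -> x r = y r.
Proof.
elim: n x y => [|n IHn] x y xB yB // + r lt_r; rewrite !big_ord_recl !muln1.
have B0 : (0 < B)%N by apply: leq_ltn_trans (xB 0%N _).
have shift (z : nat -> nat) : (\sum_(i < n) z (bump 0 i) * B ^ bump 0 i =
    (\sum_(i < n) z i.+1 * B ^ i) * B)%N.
  rewrite big_distrl; apply: eq_bigr => i _.
  by rewrite /bump /= add1n expnSr mulnA.
rewrite !shift ![(_ + _ * B)%N]addnC => e.
have e0 : x 0%N = y 0%N.
  by have := congr1 (modn^~ B) e; rewrite !modnMDl !modn_small ?xB ?yB.
case: r lt_r => [|r] lt_r //; move/(congr1 (divn^~ B)): e.
rewrite !divnMDl // !divn_small ?xB ?yB // !addn0.
by move=> /(IHn (fun i => x i.+1) (fun i => y i.+1)); apply=> // i lt_i;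
  [exact: xB | exact: yB].
Qed.

Lemma code_inj z z' : boxed z -> boxed z' -> code z = code z' -> z = z'.
Proof.
move=> /forallP bz /forallP bz' e; apply/matrixP => i j; rewrite ord1.
pose x (v : 'cV[int]_m) (r : nat) : nat :=
  if insub r is Some r' then absz (v (r' : 'I_m) 0%R) else 0%N.
have xE v (r : 'I_m) : x v r = absz (v r 0) by rewrite /x valK.
have xB (v : 'cV[int]_m) : (forall r, 0 <= v r 0 <= d%:Z) -> forall r, (r < m)%N -> (x v r < d + 1)%N.
  by move=> bv r lt_r; have := bv (Ordinal lt_r); have := xE v (Ordinal lt_r) => /=; lia.
have := @digits_inj _ m (x z) (x z') (xB z bz) (xB z' bz') _ i (ltn_ord i).
rewrite !xE => h; have := bz i; have := bz' i; move: h.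
move=> /(_ _) h; have {h} : absz (z i 0) = absz (z' i 0).
  by apply: h; under eq_bigr do rewrite xE; under [RHS]eq_bigr do rewrite xE.
lia.
Qed.

(* All layers are stored one after the other in [aL], as rows of length [m]. *)
Definition stored (s : state) (lo : nat) (T : seq 'cV[int]_m) : Prop :=
  forall p (r : 'I_m), (p < size T)%N ->
    arr s aL ((lo + p) * m + r) = (nth 0 T p r 0)%:~R.

(* The candidate is written just after the new layer, and becomes part of it when
   [vcnt] is incremented. *)
Definition candidate : cmd :=
  vok ::= Const 1 ;;; vcode ::= Const 0 ;;; vpow ::= Const 1 ;;; vres ::= Const 0 ;;;
  For vr (Var vm)
    (vval ::= Add (Get aL (Add (Mul (Add (Var vlo) (Var vj)) (Var vm)) (Var vr)))
                  (Mul (Var vk) (Get acol (Add (Mul (Var vi) (Var vm)) (Var vr)))) ;;;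
     aL[Add (Mul (Add (Add (Var vlo) (Var vlen)) (Var vcnt)) (Var vm)) (Var vr)] ::=
       Var vval ;;;
     If (Leq (Var vval) (Get ab (Var vr))) Skip (vok ::= Const 0) ;;;
     vcode ::= Add (Var vcode) (Mul (Var vval) (Var vpow)) ;;;
     vpow ::= Mul (Var vpow) (Add (Var vd) (Const 1)) ;;;
     vres ::= Add (Var vres) (Mul (Get aF (Add (Mul (Var vi) (Var vm)) (Var vr)))
                                  (Defs.Sub (Var vval) (Get ab (Var vr))))) ;;;
  If (And (Leq (Const 1) (Var vok))
        (And (Leq (Var vres) (Const 0)) (Leq (Const 0) (Var vres))))
    (If (Leq (Add (Var vi) (Const 1)) (Get aseen (Var vcode))) Skip
       (aseen[Var vcode] ::= Add (Var vi) (Const 1) ;;;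
        vcnt ::= Add (Var vcnt) (Const 1)))
    Skip.

Section Candidate.
Variables (i lo : nat) (L : seq 'cV[int]_m) (c : 'cV[int]_m) (f : 'cV[rat]_m).
Hypothesis b_le : forall r, b r 0 <= d%:Z.
Hypothesis c_ge0 : forall r, 0 <= c r 0.
Hypothesis L_ge0 : forall y r, y \in L -> 0 <= y r 0.

Record search_env (s : state) : Prop := SearchEnv {
  env_m : var s vm = m%:R;
  env_d : var s vd = d%:R;
  env_i : var s vi = i%:R;
  env_lo : var s vlo = lo%:R;
  env_len : var s vlen = (size L)%:R;
  env_col : forall r : 'I_m, arr s acol (i * m + r) = (c r 0)%:~R;
  env_F : forall r : 'I_m, arr s aF (i * m + r) = f r 0;
  env_b : forall r : 'I_m, arr s ab r = (b r 0)%:~R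
}.

Lemma search_env_agree cm s s' : agree cm s s' ->
  all [pred x | x \notin written_vars cm] [:: vm; vd; vi; vlo; vlen] ->
  all [pred a | a \notin written_arrs cm] [:: acol; aF; ab] ->
  search_env s -> search_env s'.
Proof.
move=> [V A] /= /and5P[h1 h2 h3 h4 /andP[h5 _]] /and4P[a1 a2 a3 _] [].
move=> Em Ed Ei Elo Elen Ec EF Eb; split; rewrite ?V //.
- by move=> r; rewrite A.
- by move=> r; rewrite A.
- by move=> r; rewrite A.
Qed.

(* Recorded vectors carry the stamp [i.+1] of the current layer; the stamps of the
   earlier layers are smaller, so the array needs no clearing. *)
Record search_inv (s : state) (T : seq 'cV[int]_m) : Prop := SearchInv {
  inv_cnt : var s vcnt = (size T)%:R;
  inv_L : stored s lo L;
  inv_T : stored s (lo + size L) T;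
  inv_seen : forall z, boxed z -> (i.+1%:R <= arr s aseen (code z)) = (z \in T);
  inv_max : forall p, arr s aseen p <= i.+1%:R
}.

Lemma boxed_admissible (z : 'cV[int]_m) : (forall r, 0 <= z r 0) -> admissible b f z -> boxed z.
Proof.
move=> z0 /andP[/forallP zb _]; apply/forallP => r.
by rewrite z0 (le_trans (zb r) (b_le r)).
Qed.

Lemma run_candidate s T p j :
  search_env s -> search_inv s T -> (p < size L)%N ->
  var s vj = p%:R -> var s vk = j%:R ->
  run candidate s (m * 80 + 60) (fun s' =>
    search_inv s' (insert b f T (nth 0 L p + j%:Z *: c))).
Proof.
move=> env inv lt_p Ej Ek; set y := nth 0 L p; set z := y + j%:Z *: c.
have yL : y \in L by exact: mem_nth.
have z0 r : 0 <= z r 0.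
  by rewrite !mxE addr_ge0 ?L_ge0 // mulr_ge0.
pose at_new k := k == (lo + size L + size T)%N.
apply: run_le; [do 4 (apply: run_seq; assign) | idtac].
apply: run_seq; apply: (run_for (I := fun r' s' =>
   [/\ var s' vok = [forall r : 'I_m, (r < r')%N ==> (z r 0 <= b r 0)]%:R,
       var s' vcode = (partial_code z r')%:R,
       var s' vpow = ((d + 1) ^ r')%N%:R,
       var s' vres = \sum_(r < m | (r < r')%N) f r 0 * (z r 0 - b r 0)%:~R
     & forall k (r : 'I_m), arr s' aL (k * m + r) =
         if at_new k && (r < r')%N then (z r 0)%:~R else arr s aL (k * m + r)])
  (T := 70) (N := m) _ _ _ _ _ (leqnn _)) => //.
- by move=> s' ag; apply: eval_var; rewrite (ag.1 vm) //= env_m.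
- split; [by rewrite forall_lt0 | by rewrite partial_code0 | by []
         | by rewrite sum_lt0 | by move=> k r; rewrite andbF].
- move=> i' s1 lt_i' ag Er [Iok Icode Ipow Ires IL]; pose r0 := Ordinal lt_i'.
  have env1 : search_env s1.
    by apply: search_env_agree ag _ _ _; rewrite //; case: env; split.
  have [Em1 Ed1 Ei1 Elo1 Elen1 Ec1 EF1 Eb1] := env1.
  have Ej1 : var s1 vj = p%:R by rewrite (ag.1 vj).
  have Ek1 : var s1 vk = j%:R by rewrite (ag.1 vk).
  have Ecnt1 : var s1 vcnt = (size T)%:R by rewrite (ag.1 vcnt) //= (inv_cnt inv).
  have EL1 : arr s1 aL ((lo + p) * m + i') = (y r0 0)%:~R.
    rewrite (IL _ r0) ltnn andbF; exact: (inv_L inv r0 lt_p).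
  have Ecr : arr s1 acol (i * m + i') = (c r0 0)%:~R by exact: (Ec1 r0).
  have EFr : arr s1 aF (i * m + i') = f r0 0 by exact: (EF1 r0).
  have Ebr : arr s1 ab i' = (b r0 0)%:~R by exact: (Eb1 r0).
  apply: run_le; [apply: run_seq; assign | idtac].
  have -> : (y r0 0)%:~R + j%:R * (c r0 0)%:~R = (z r0 0)%:~R :> rat.
    by rewrite !mxE rmorphD rmorphM.
  apply: run_seq; store; apply: run_seq; apply: (run_if (T := 2)).
    by apply: eval_leq; ev.
  rewrite ler_int; set s2 := set_arr _ _ _ _.
  (* Both branches of the comparison change at most [vok], so the rest of the body is treated once
     for the two. *)
  have rest s3 : agree (vok ::= Const 0) s2 s3 ->
      var s3 vok = [forall r : 'I_m, (r < i'.+1)%N ==> (z r 0 <= b r 0)]%:R ->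
      run (vcode ::= Add (Var vcode) (Mul (Var vval) (Var vpow)) ;;;
           vpow ::= Mul (Var vpow) (Add (Var vd) (Const 1)) ;;;
           vres ::= Add (Var vres) (Mul (Get aF (Add (Mul (Var vi) (Var vm)) (Var vr)))
                                  (Defs.Sub (Var vval) (Get ab (Var vr))))) s3 26
        (fun s' => [/\
         var s' vok = [forall r : 'I_m, (r < i'.+1)%N ==> (z r 0 <= b r 0)]%:R,
         var s' vcode = (partial_code z i'.+1)%:R,
         var s' vpow = ((d + 1) ^ i'.+1)%N%:R,
         var s' vres = \sum_(r < m | (r < i'.+1)%N) f r 0 * (z r 0 - b r 0)%:~R
       & forall k (r : 'I_m), arr s' aL (k * m + r) =
         if at_new k && (r < i'.+1)%N then (z r 0)%:~R else arr s aL (k * m + r)]).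
    move=> ag3 Eok.
    have Ecode3 : var s3 vcode = (partial_code z i')%:R by rewrite (ag3.1 vcode).
    have Epow3 : var s3 vpow = ((d + 1) ^ i')%N%:R by rewrite (ag3.1 vpow).
    have Eres3 : var s3 vres = \sum_(r < m | (r < i')%N) f r 0 * (z r 0 - b r 0)%:~R.
      by rewrite (ag3.1 vres).
    have Eval3 : var s3 vval = (z r0 0)%:~R by rewrite (ag3.1 vval).
    have Ed3 : var s3 vd = d%:R by rewrite (ag3.1 vd).
    have Em3 : var s3 vm = m%:R by rewrite (ag3.1 vm).
    have Ei3 : var s3 vi = i%:R by rewrite (ag3.1 vi).
    have Er3 : var s3 vr = i'%:R by rewrite (ag3.1 vr).
    have EF3 : arr s3 aF (i * m + i') = f r0 0 by rewrite (ag3.2 aF).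
    have Eb3 : arr s3 ab i' = (b r0 0)%:~R by rewrite (ag3.2 ab).
    apply: (@run_seq _ _ _ 6); assign.
    apply: (@run_seq _ _ _ 6); assign; assign; split=> //=.
    + rewrite (partial_codeS _ lt_i') natrD natrM; congr (_ + _ * _).
      by rewrite -{1}[z r0 0]gez0_abs // -pmulrn.
    + by rewrite expnSr.
    + by rewrite (sum_ltS _ lt_i') rmorphB.
    move=> k r; rewrite (ag3.2 aL) //= -[i']/(nat_of_ord r0) index_eq IL /at_new.
    case: eqVneq => //= _; have [-> //|rr] := eqVneq r r0; first by rewrite ltnS leqnn.
    have {}rr : (r : nat) != i' := rr.
    by have -> : (r < i'.+1)%N = (r < i')%N by lia.
  case: ifP => zb.
    apply: run_le (run_skip _) _ => //; apply: rest => //.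
    by rewrite /= Iok (forall_ltS _ lt_i') zb andbT.
  assign; apply: rest; first by split=> // x; rewrite inE => /negPf /= ->.
  by rewrite /= (forall_ltS _ lt_i') zb andbF.
  by [].
move=> s1 ag [/= Iok Icode Ipow Ires IL].
have env1 : search_env s1.
  by apply: search_env_agree ag _ _ _; rewrite //; case: env; split.
have Ei1 := env_i env1.
have Ecnt1 : var s1 vcnt = (size T)%:R by rewrite (ag.1 vcnt) //= (inv_cnt inv).
rewrite forall_ltT in Iok; rewrite partial_codeT in Icode; rewrite sum_ltT in Ires.
have EL1 : stored s1 lo L.
  move=> p' r lt_p'; rewrite IL /at_new (inv_L inv) //.
  by case: eqP => //; lia.
have ET1 : stored s1 (lo + size L) T.
  move=> p' r lt_p'; rewrite IL /at_new (inv_T inv) //.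
  by case: eqP => //; lia.
have Es1 q : arr s1 aseen q = arr s aseen q by rewrite (ag.2 aseen).
have {}Ires : var s1 vres = residual b f z := Ires.
have testE : (1%:R <= [forall r, z r 0 <= b r 0]%:R :> rat) &&
    ((residual b f z <= 0%:R) && (0%:R <= residual b f z)) = admissible b f z.
  by rewrite ler_nat -eq_le /admissible; case: [forall r, _].
apply: (run_if (T := 20)).
  by do 2! (apply: eval_and; first (by apply: eval_leq; ev)); apply: eval_leq; ev.
rewrite testE.
rewrite /insert; case adm : (admissible b f z) => /=; last first.
  apply: run_le (run_skip _) _ => //; split=> //.
  + by move=> z' bz'; rewrite Es1 (inv_seen inv).
  + by move=> q; rewrite Es1 (inv_max inv).
(* Codes identify vectors only inside the box; only admissible candidates are looked up, and they
   are in it. *)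
have bz : boxed z by exact: boxed_admissible adm.
have Esz : arr s1 aseen (code z) = arr s aseen (code z) by exact: Es1.
apply: (run_if (T := 13)); first by apply: eval_leq; ev.
rewrite addn1 (inv_seen inv) //; case zT : (z \in T) => /=.
  apply: run_le (run_skip _) _ => //; split=> //.
  + by move=> z' bz'; rewrite Es1 (inv_seen inv).
  + by move=> q; rewrite Es1 (inv_max inv).
apply: (@run_seq_le 5 4) => //; store; assign; split=> /=.
- by rewrite size_rcons addn1.
- exact: EL1.
- move=> p' r; rewrite size_rcons ltnS leq_eqVlt nth_rcons => /orP[/eqP ->|lt_p'].
    by rewrite ltnn eqxx /= IL /at_new eqxx ltn_ord.
  by rewrite lt_p'; exact: ET1.
- move=> z' bz'; rewrite mem_rcons inE addn1; case: eqVneq => [/esym e|ne].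
    by rewrite (code_inj bz' bz (esym e)) eqxx lexx.
  rewrite Es1 (inv_seen inv) //; case: eqVneq => // e; by rewrite e eqxx in ne.
- by move=> q; case: ifP => _; rewrite ?addn1 // Es1 (inv_max inv).
by rewrite /=; lia.
Qed.

Lemma search_inv_set s T x v :
  x != vcnt -> search_inv s T -> search_inv (set_var s x v) T.
Proof. by move=> xcnt []; split=> //=; rewrite eq_sym (negPf xcnt). Qed.

Definition extend_state : cmd := For vk (Add (Var vd) (Const 1)) candidate.

Lemma run_extend_state s T p :
  search_env s -> search_inv s T -> (p < size L)%N -> var s vj = p%:R ->
  run extend_state s ((d + 1) * (m * 80 + 71) + 9)
    (fun s' => search_inv s' (extend b d f c T (nth 0 L p))).
Proof.
move=> env inv lt_p Ej.
apply: (run_for (I := fun j s' => search_inv s'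
    (foldl (insert b f) T [seq nth 0 L p + k%:Z *: c | k <- iota 0 j]))
  (T := (m * 80 + 60)%N) (N := (d + 1)%N)) => //.
- move=> s' ag; have Ed : var s' vd = d%:R by rewrite (ag.1 vd) // env_d.
  by ev.
- by move=> j s' v; exact: search_inv_set.
- move=> j s1 lt_j ag Ek inv1.
  have env1 : search_env s1 by apply: search_env_agree ag _ _ env.
  rewrite -[j.+1]addn1 iotaD map_cat foldl_cat /=.
  by apply: run_candidate => //; rewrite (ag.1 vj).
- by rewrite /=; lia.
by move=> s' _; rewrite addn1.
Qed.

Definition extend_layer : cmd := For vj (Var vlen) extend_state.

Lemma run_extend_layer s :
  search_env s -> search_inv s [::] ->
  run extend_layer s (size L * ((d + 1) * (m * 80 + 71) + 18) + 7)
    (fun s' => search_inv s' (foldl (extend b d f c) [::] L)).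
Proof.
move=> env inv.
apply: (run_for (I := fun p s' => search_inv s' (foldl (extend b d f c) [::] (take p L)))
  (T := ((d + 1) * (m * 80 + 71) + 9)%N) (N := size L)) => //.
- by move=> s' ag; apply: eval_var; rewrite (ag.1 vlen) // env_len.
- by move=> p s' v; exact: search_inv_set.
- by rewrite take0.
- move=> p s1 lt_p ag Ej inv1.
  have env1 : search_env s1 by apply: search_env_agree ag _ _ env.
  rewrite (take_nth 0 lt_p) foldl_rcons.
  exact: run_extend_state.
- by rewrite /=; lia.
by move=> s' _; rewrite take_size.
Qed.

End Candidate.

Definition search : cmd :=
  For vi (Var vK)
    (vcnt ::= Const 0 ;;; extend_layer ;;;
     vlo ::= Add (Var vlo) (Var vlen) ;;; vlen ::= Var vcnt).

Lemma run_search (C : nat -> 'cV[int]_m) K B s :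
  (forall r, b r 0 <= d%:Z) -> (forall k r, 0 <= C k r 0) ->
  (forall k, (k <= K)%N -> (size (layer C b K d k) <= B)%N) ->
  (0 < m)%N -> var s vm = m%:R -> var s vK = K%:R -> var s vd = d%:R ->
  (forall k (r : 'I_m), arr s acol (k * m + r) = (C k r 0)%:~R) ->
  (forall k (r : 'I_m), (k < K)%N -> arr s aF (k * m + r) = functional C K k r 0) ->
  (forall r : 'I_m, arr s ab r = (b r 0)%:~R) ->
  var s vlo = 0 -> var s vlen = 1 ->
  (forall p, arr s aL p = 0) -> (forall p, arr s aseen p = 0) ->
  run search s (K * (B * ((d + 1) * (m * 169)) + 24) + 7) (fun s' =>
    exists lo, [/\ var s' vlo = lo%:R, var s' vlen = (size (layer C b K d K))%:R
                 & stored s' lo (layer C b K d K)]).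
Proof.
move=> b_le C0 size_B m0 Em EK Ed Ec EF Eb Elo Elen EL Es.
apply: (run_for (I := fun k s' => exists lo,
    [/\ var s' vlo = lo%:R, var s' vlen = (size (layer C b K d k))%:R,
        stored s' lo (layer C b K d k) & forall p, arr s' aseen p <= k%:R])
  (T := (B * ((d + 1) * (m * 169)) + 15)%N) (N := K)) => //.
- by move=> s' ag; apply: eval_var; rewrite (ag.1 vK).
(* The initial layer needs no store: an unwritten row of [aL] is already the zero vector. *)
- exists 0%N; split=> //= [p r|p]; last by rewrite Es.
  by rewrite ltnS leqn0 => /eqP -> /=; rewrite EL mxE.
- move=> k s1 lt_k ag Ei [lo [Elo1 Elen1 L1 S1]].
  apply: (@run_seq_le 2 (B * ((d + 1) * (m * 169)) + 13)); [by lia | assign].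
  set s2 := set_var _ _ _.
  have env : search_env k lo (layer C b K d k) (C k) (functional C K k) s2.
    split=> //=; rewrite ?(ag.1 vm) ?(ag.1 vd) //.
    - by move=> r; rewrite (ag.2 acol).
    - by move=> r; rewrite (ag.2 aF) // EF.
    - by move=> r; rewrite (ag.2 ab).
  have inv : search_inv k lo (layer C b K d k) s2 [::].
    split=> //= [z bz|p]; first apply/negbTE; rewrite -?ltNge.
      by apply: le_lt_trans (S1 _) _; rewrite ltr_nat.
    by apply: le_trans (S1 _) _; rewrite ler_nat.
  have L0 y r : y \in layer C b K d k -> 0 <= y r 0.
    by move=> /(layer_box C0 b_le r)/andP[].
  apply: (@run_seq_le (B * ((d + 1) * (m * 169)) + 7) 6); first by lia.
  apply: run_conseq (run_extend_layer b_le (C0 k) L0 env inv) _ _.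
    (* [169 = 80 + 71 + 18]: the lower-order terms are absorbed because [m] and [d + 1] are
       positive. *)
    rewrite leq_add2r; apply: leq_mul; first by apply: size_B; exact: ltnW.
    by nia.
  move=> s3 ag3 inv3.
  have Elo3 : var s3 vlo = lo%:R by rewrite (ag3.1 vlo).
  have Elen3 : var s3 vlen = (size (layer C b K d k))%:R by rewrite (ag3.1 vlen).
  have Ecnt3 := inv_cnt inv3.
  apply: (@run_seq_le 4 2); [by [] | assign; assign].
  exists (lo + size (layer C b K d k))%N; split=> //=.
  + exact: inv_T inv3.
  + exact: inv_max inv3.
- by rewrite /=; lia.
by move=> s' _ [lo [h1 h2 h3 _]]; exists lo.
Qed.

(** The number of rows occupies variable 0, where the answer has to go; the answer is therefore
    collected in [vfound] and moved at the very end. *)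
Definition verdict : cmd :=
  vfound ::= Const 0 ;;;
  For vj (Var vlen)
    (vok ::= Const 1 ;;;
     For vr (Var vm)
       (If (And (Leq (Get aL (Add (Mul (Add (Var vlo) (Var vj)) (Var vm)) (Var vr)))
                     (Get ab (Var vr)))
                (Leq (Get ab (Var vr))
                     (Get aL (Add (Mul (Add (Var vlo) (Var vj)) (Var vm)) (Var vr)))))
          Skip (vok ::= Const 0)) ;;;
     If (Leq (Const 1) (Var vok)) (vfound ::= Const 1) Skip) ;;;
  vm ::= Var vfound.

Lemma run_verdict lo (L : seq 'cV[int]_m) s :
  var s vm = m%:R -> var s vlo = lo%:R -> var s vlen = (size L)%:R ->
  stored s lo L -> (forall r : 'I_m, arr s ab r = (b r 0)%:~R) ->
  run verdict s (size L * (m * 50 + 40) + 20) (fun s' => var s' vm = (b \in L)%:R).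
Proof.
move=> Em Elo Elen EL Eb.
apply: (@run_seq_le 2 (size L * (m * 50 + 40) + 18)); [by lia | assign].
apply: (@run_seq_le (size L * (m * 50 + 40) + 16) 2); first by lia.
apply: (run_for (I := fun p s' => var s' vfound = (b \in take p L)%:R)
  (T := (m * 42 + 25)%N) (N := size L)) => //; last 2 first.
- by rewrite /=; lia.
- by move=> s1 _ Ef; rewrite take_size in Ef; assign.
- by move=> s' ag; apply: eval_var; rewrite (ag.1 vlen).
- by rewrite take0.
move=> p s1 lt_p ag Ej Ef; set y := nth 0 L p.
apply: (@run_seq_le 2 (m * 42 + 23)); [by lia | assign].
apply: (@run_seq_le (m * 42 + 7) 6); first by lia.
apply: (run_for (I := fun i s' =>
    var s' vok = [forall r : 'I_m, (r < i)%N ==> (y r 0 == b r 0)]%:R)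
  (T := 26) (N := m)) => //.
- by move=> s' ag2; apply: eval_var; rewrite (ag2.1 vm) //= (ag.1 vm).
- by rewrite forall_lt0.
- move=> i s2 lt_i ag2 Er Iok; pose r0 := Ordinal lt_i.
  have Em2 : var s2 vm = m%:R by rewrite (ag2.1 vm) //= (ag.1 vm).
  have Elo2 : var s2 vlo = lo%:R by rewrite (ag2.1 vlo) //= (ag.1 vlo).
  have Ej2 : var s2 vj = p%:R by rewrite (ag2.1 vj).
  have EL2 : arr s2 aL ((lo + p) * m + i) = (y r0 0)%:~R.
    by rewrite (ag2.2 aL) //= (ag.2 aL) //= (EL p r0).
  have Eb2 : arr s2 ab i = (b r0 0)%:~R.
    by rewrite (ag2.2 ab) //= (ag.2 ab) //= (Eb r0).
  apply: (run_if (T := 2)).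
    by apply: eval_and; apply: eval_leq; ev.
  rewrite !ler_int -eq_le; case: ifP => yb.
    by apply: run_le (run_skip _) _ => //; rewrite (forall_ltS _ lt_i) Iok yb andbT.
  by assign; rewrite /= (forall_ltS _ lt_i) yb andbF.
- by rewrite /=; lia.
move=> s2 ag2; rewrite forall_ltT => Eok.
have yb : [forall r, y r 0 == b r 0] = (b == y).
  apply/forallP/eqP => [h|-> //]; apply/matrixP => i j.
  by rewrite ord1; exact/esym/eqP.
rewrite yb in Eok; apply: (run_if (T := 2)); first by apply: eval_leq; ev.
rewrite ler_nat (take_nth 0 lt_p) mem_rcons inE -/y.
case: (b == y) => /=; first by assign.
by apply: run_le (run_skip _) _ => //; rewrite (ag2.1 vfound).
Qed.

End Search.

(** * The solver *)

Lemma nth_flatten_const (T : Type) (x0 : T) (w : nat) (ss : seq (seq T)) i j :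
  all (fun s => size s == w) ss -> (i < size ss)%N -> (j < w)%N ->
  nth x0 (flatten ss) (i * w + j) = nth x0 (nth [::] ss i) j.
Proof.
move=> + + lt_j; elim: ss i => [|s ss IHss] //= i /andP[/eqP sw ws].
case: i => [|i] lt_i; rewrite nth_cat sw; first by rewrite lt_j.
by rewrite mulSn -addnA ltnNge leq_addr /= addKn IHss.
Qed.

Section Input.
Variables (m n : nat) (A : 'M[int]_(m, n)) (b : 'cV[int]_m) (D : labelled_graph n).

Lemma input_A (i : 'I_m) (j : 'I_n) :
  arr (input A b D) aA (i * n + j) = (A i j)%:~R.
Proof.
transitivity (nth (0 : rat)
    [seq (A i j)%:~R | i <- enum 'I_m, j <- enum 'I_n] (i * n + j)); first by [].
rewrite (@nth_flatten_const _ _ n) //; last 2 first.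
- by apply/allP => s /mapP[i' _ ->]; rewrite size_map size_enum_ord.
- by rewrite size_map size_enum_ord.
rewrite (nth_map i) ?size_enum_ord // nth_ord_enum.
by rewrite (nth_map j) ?size_enum_ord // nth_ord_enum.
Qed.

Lemma input_b (i : 'I_m) : arr (input A b D) ab i = (b i 0)%:~R.
Proof. by rewrite /= (nth_map i) ?size_enum_ord // nth_ord_enum. Qed.

Lemma input_label (j : 'I_n) : arr (input A b D) alabel j = (label D j : nat)%:R.
Proof. by rewrite /= (nth_map j) ?size_enum_ord // nth_ord_enum. Qed.

Lemma input_zero a p : (3 < a)%N -> arr (input A b D) a p = 0.
Proof. by case: a => [|[|[|[|a]]]] //= _; rewrite !nth_nil. Qed.

Lemma input_edge i e : (i < size (edges D))%N ->
  arr (input A b D) aedge (2 * i) = ((nth e (edges D) i).1 : nat)%:R /\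
  arr (input A b D) aedge (2 * i + 1) = ((nth e (edges D) i).2 : nat)%:R.
Proof.
move=> lt_i; rewrite mulnC -[X in _ aedge X = _]addn0 /=.
by rewrite !nth_flatten_const ?size_map // ?(nth_map e) //; apply/allP => s /mapP[? _ ->].
Qed.

End Input.

Lemma agree_assign x e s v : agree (x ::= e) s (set_var s x v).
Proof. by split=> // y; rewrite inE => /negPf /= ->. Qed.

(** [W] stands for [(d + 1) ^ k] and [B] for [d + 1]. There are at most [6 n] slots, whence
    [1020 = 6 * 170] for the sweep and the factor [6 n] of the search; [33 = 17 + 16] covers the
    maximum and the identity matrix. *)
Lemma time_le m n W B : (0 < m)%N -> (0 < n)%N -> (0 < W)%N -> (0 < B)%N ->
  (n * m * 500 + m * 33 + n * (m * (m * 1020)) + 6 * n * (W * (B * (m * 169)) + 24) +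
   W * (m * 50 + 40) + 100 <= 4000 * (W * B * m * n + m * m * n))%N.
Proof.
move=> m0 n0 W0 B0.
have h1 : (m <= n * m)%N by rewrite leq_pmull.
have h2 : (n <= n * m)%N by rewrite leq_pmulr.
have h3 : (n * m <= m * m * n)%N by rewrite mulnC leq_mul2r leq_pmulr ?orbT.
have h4 : (W * m <= W * m * (B * n))%N by rewrite leq_pmulr // muln_gt0 B0.
have h5 : (W <= W * m)%N by rewrite leq_pmulr.
lia.
Qed.

Section Correctness.
Variables (m n : nat) (A : 'M[int]_(m, n)) (b : 'cV[int]_m) (D : labelled_graph n).
Hypotheses (n0 : (0 < n)%N) (m0 : (0 < m)%N) (A0 : forall i j, 0 <= A i j).
Hypothesis D_path : is_path_decomposition D.

Let D_simple : simple_edges D. Proof. by case: D_path. Qed.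
Let D_caterpillar : is_caterpillar D. Proof. by case: D_path. Qed.
Let D_cubic : is_cubic D. Proof. by case: D_path. Qed.
Let D_labels : labels_leaves D. Proof. by case: D_path. Qed.

Lemma max_entry_le r : b r 0 <= (max_entry b)%:Z.
Proof.
rewrite /max_entry gez0_abs ?bigmax_ge_id //.
exact: (le_bigmax _ (fun i => b i ord0)).
Qed.

Section Slots.
Variable q : seq 'I_(n_vertices D).
Hypothesis q_spine : is_spine q.
Let C := slot_col A q.
Let K := (3 * (size q).+1)%N.

Lemma slot_col_ge0 k r : 0 <= C k r 0.
Proof. by rewrite /C /slot_col summxE sumr_ge0 // => j _; rewrite mxE. Qed.

(** The slots permute the columns and pad them with zero columns, so solutions transfer in both
    directions. *)
Lemma slot_col_feasible :
  ip_feasible A b <-> exists x : nat -> nat, b = \sum_(k < K) (x k)%:Z *: C k.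
Proof.
have sumE (x : nat -> nat) :
    \sum_(k < K) (x k)%:Z *: C k = A *m (\col_j (x (slot q j))%:Z).
  transitivity (\sum_(k < K) \sum_(j | slot q j == k) (x (slot q j))%:Z *: col j A).
    apply: eq_bigr => k _; rewrite /C /slot_col scaler_sumr.
    by apply: eq_bigr => j /eqP ->.
  rewrite (exchange_big_dep xpredT) //=; apply/matrixP => r u; rewrite ord1.
  rewrite summxE mxE; apply: eq_bigr => j _.
  rewrite (big_pred1 (Ordinal (slot_lt D_cubic D_caterpillar D_labels q_spine j))).
    by rewrite !mxE mulrC.
  by move=> k; rewrite eq_sym.
split=> [[x [x0 xE]]|[x ->]]; last first.
  by exists (\col_j (x (slot q j))%:Z); split=> // j; rewrite mxE.
pose y k := (\sum_(j | slot q j == k) absz (x j 0%R))%N.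
exists y; rewrite sumE -xE; congr (A *m _); apply/matrixP => j u.
rewrite ord1 mxE /y (big_pred1 j) ?gez0_abs ?x0 // => i.
by rewrite (inj_eq (slot_inj D_cubic D_caterpillar D_labels q_spine)).
Qed.

Lemma slot_spaces k : (k <= K)%N ->
  (\dim (prefix_space C k :&: suffix_space C K k) <= width D A)%N.
Proof.
move=> le_kK; pose X := [set j | (slot q j < k)%N].
apply: leq_trans (meet_slot_le D_cubic D_caterpillar D_labels q_spine A k).
have colE i (Y : {set 'I_n}) : (forall j, slot q j = i -> j \in Y) ->
    ratv (C i) \in col_space A Y.
  move=> h; rewrite /C /slot_col ratv_sum; apply: memv_suml => j /eqP /h jY.
  by rewrite /ratv map_col; exact: rat_col_in.
rewrite /meet_dim; apply/dimvS/capvS.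
  apply/subv_sumP => i _; rewrite -memvE; apply: colE => j ji.
  by rewrite inE ji.
rewrite /suffix_space big_seq; elim/big_ind: _ => [|U V sU sV|i].
- exact: sub0v.
- by rewrite subv_add sU sV.
rewrite mem_index_iota => /andP[ki _].
by rewrite -memvE; apply: colE => j ji; rewrite !inE ji -leqNgt.
Qed.

(** Without a spine the neighbour sum is 0, and the program reads the place of vertex 0; it is 0,
    and so is the key. *)
Lemma label_place j : exists2 u : 'I_(n_vertices D),
  nbr_sum (@nat_of_ord _) (label D j) = u & key q j = place q u.
Proof.
have [q0|q0] := posnP (size q); last first.
  have [u uq [au ku]] := keyP D_caterpillar D_labels q_spine j q0.
  exists u => //; rewrite /nbr_sum (big_pred1 u) // => w.
  by rewrite au /=; case: eqP => //= ->; rewrite -(mem_spine q_spine).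
have N0 : (0 < n_vertices D)%N := leq_ltn_trans (leq0n _) (ltn_ord (label D j)).
exists (Ordinal N0); last by rewrite key_nil // /place (size0nil q0).
rewrite /nbr_sum big1 // => w /andP[_].
by rewrite -(mem_spine q_spine) (size0nil q0).
Qed.

End Slots.

Definition locate : cmd :=
  mark_leaves ;;; sum_neighbours ;;; find_end ;;; walk ;;; arrange.

(** Traces the content of a cell back through the frame conditions to the state where it was last
    written. *)
Ltac back := repeat match goal with
  | ag : agree _ _ ?s |- context [var ?s ?x] => rewrite (proj1 ag x isT)
  | ag : agree _ _ ?s |- context [arr ?s ?a ?p] => rewrite (proj2 ag a p isT)
  end.

Lemma run_locate :
  run locate (input A b D) (n * m * 500) (fun s => exists q : seq 'I_(n_vertices D),
    [/\ is_spine q, var s vT = (size q)%:R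
      & forall k (r : 'I_m), arr s acol (k * m + r) = (slot_col A q k r 0)%:~R]).
Proof.
set s0 := input A b D.
have [q0 q0_spine] := spine_exists D_simple D_caterpillar.
have NE := n_vertices_spine D_labels q0_spine.
have q0_le := size_spine_le D_cubic D_caterpillar D_labels q0_spine.
have E_le := size_edges_le D_simple D_cubic.
apply: run_le.
apply: run_seq; apply: run_weaken (run_mark_leaves D_labels _ _ _) _ => //.
- exact: input_label.
- by move=> r; exact: input_zero.
move=> s1 ag1 El1; apply: run_seq.
apply: run_weaken (run_sum_neighbours D_simple _ _ El1 _ _) _;
  try by (move=> *; back; rewrite ?input_zero).
  by move=> i e lt_i; back; exact: input_edge.
move=> s2 ag2 Es2; apply: run_seq.
have El2 (v : 'I_(n_vertices D)) : arr s2 aleaf v = (is_leaf v)%:R by back.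
have EN2 : var s2 vN = (n_vertices D)%:R by back.
apply: run_weaken (run_find_end EN2 El2 (fun v => proj2 (Es2 v))) _.
move=> s3 ag3 Ecur3.
pose v0 := label D (Ordinal n0).
(* The end found by the machine fixes the direction in which the spine is read; the length is the
   same for every spine, by [n_vertices_spine]. *)
have [q q_spine [q_size q_head]] : exists2 q, is_spine q & size q = size q0 /\
    ((0 < size q)%N -> var s3 vcur = (nth v0 q 0 : nat)%:R).
  have [e|q_gt0] := posnP (size q0); first by exists q0 => //; rewrite e.
  have [|v /andP[vI v1] Ev] := Ecur3 (nth v0 q0 0).
    rewrite /spine_end -(mem_spine q0_spine) mem_nth //=.
    by rewrite /nbr_sum (spine_sum q0_spine) //=; case: ifP.
  have [q q_spine [q0' qv]] := spine_start D_simple D_caterpillar vI v1.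
  exists q => //; split; last by rewrite (set_nth_default v) ?qv.
  by have := n_vertices_spine D_labels q_spine; lia.
apply: run_seq; apply: (@run_conseq _ _ _ (size q0 * 23 + 11) _ _
  (@run_walk _ D s3 q v0 q_spine _ _ _ _ _ q_head));
  try by (move=> *; back; rewrite ?input_zero).
- by back; rewrite q_size; exact: (congr1 (fun i => i%:R) NE).
- by move=> v; back; case: (Es2 v).
- by rewrite q_size.
move=> s4 ag4 [ET4 Ep4].
apply: run_weaken (@run_arrange n D m A s4 q m0 _ _ _ _ _ Ep4 (label_place q_spine) _ _) _;
  try by (move=> *; back; rewrite ?input_zero).
- by move=> i j; back; exact: input_A.
- by move=> j; back; exact: input_label.
- by move=> v; back; case: (Es2 v).
- by move=> s5 ag5 Ec5; exists q; split=> //; back.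
(* There are at most [2 n] vertices and [3 n] edges, so all steps but [arrange] are linear in
   [n]. *)
nia.
Qed.

Definition solver : cmd :=
  locate ;;; compute_max ;;; init_sweep ;;;
  vK ::= Mul (Const 3) (Add (Var vT) (Const 1)) ;;;
  sweep_columns ;;; vlen ::= Const 1 ;;; search ;;; verdict.

Lemma run_solver :
  run solver (input A b D)
    (4000 * ((max_entry b + 1) ^ (width D A + 1) * m * n + m ^ 2 * n))
    (fun s => answers s (ip_feasible A b)).
Proof.
set s0 := input A b D; set d := max_entry b; set k := width D A.
apply: run_le.
apply: run_seq; apply: run_weaken run_locate _ => s1 ag1 [q [q_spine ET1 Ec1]].
pose C := slot_col A q; pose K := (3 * (size q).+1)%N.
have C0 := @slot_col_ge0 q.
have q_le := size_spine_le D_cubic D_caterpillar D_labels q_spine.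
apply: run_seq; apply: run_weaken (@run_compute_max m b s1 _ _ _) _;
  try by (move=> *; back; rewrite ?input_zero).
  by move=> r; back; exact: input_b.
move=> s2 ag2 Ed2; apply: run_seq.
apply: run_weaken (@run_init_sweep m s2 _ _) _; try by (move=> *; back; rewrite ?input_zero).
move=> s3 ag3 EM3.
have ET3 : var s3 vT = (size q)%:R by back.
apply: run_seq; assign.
set s4 := set_var _ _ _.
have EK4 : var s4 vK = K%:R by exact: (congr1 (fun i => (3 * i)%:R) (addn1 _)).
(* [agree] depends only on the variable assigned, so [Const 0] can replace the actual expression;
   [back] needs this fact to pass through [s4]. *)
have ag4 : agree (vK ::= Const 0) s3 s4 by exact: agree_assign.
apply: run_seq.
apply: (@run_conseq _ _ _ (n * (m * (m * 1020)) + 7) _ _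
  (@run_sweep_columns m C K s4 m0 _ EK4 _ _)) => //=.
- by back.
- by move=> j r; back.
- by rewrite /K; nia.
move=> s5 ag5 EF5; apply: run_seq; assign; set s6 := set_var _ _ _.
have ag6 : agree (vlen ::= Const 0) s5 s6 by exact: agree_assign.
have b6 (r : 'I_m) : arr s6 ab r = (b r 0)%:~R by back; exact: input_b.
have sizeB j : (j <= K)%N -> (size (layer C b K d j) <= (d + 1) ^ k)%N.
  by move=> le_j; apply: size_layer => //; [exact: max_entry_le | exact: slot_spaces].
apply: run_seq.
apply: (@run_conseq _ _ _
  (6 * n * ((d + 1) ^ k * ((d + 1) * (m * 169)) + 24) + 7) _ _
  (@run_search m d b C K ((d + 1) ^ k)%N s6 _ C0 sizeB m0 _ _ _ _ _ b6 _ _ _ _));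
  try by (move=> *; back; rewrite ?input_zero).
- exact: max_entry_le.
- by move=> j r lt_j; back; exact: EF5.
- by rewrite leq_add2r leq_mul // /K; lia.
move=> s7 ag7 [lo [Elo7 Elen7 L7]].
apply: (@run_conseq _ _ _ ((d + 1) ^ k * (m * 50 + 40) + 20) _ _
  (@run_verdict m b lo _ s7 _ Elo7 Elen7 L7 _)).
- by back => /=; back.
- by move=> r; rewrite (ag7.2 ab _ isT) b6.
- by rewrite leq_add2r leq_mul // sizeB.
move=> s8 _ E8; rewrite /answers E8; have := layer_feasible K C0 max_entry_le.
rewrite -/C -/d => lf; have sf := slot_col_feasible q_spine.
case: (boolP (b \in _)) => bL; [left | right]; split=> //.
    by apply/sf/lf.
  by move=> /sf/lf; exact/negP.
rewrite expnD expn1 -mulnn.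
have [W0 B0] : (0 < (d + 1) ^ k)%N /\ (0 < d + 1)%N by rewrite expn_gt0 addn1.
by apply: leq_trans (time_le m0 n0 W0 B0); rewrite /=; lia.
Qed.

End Correctness.

Theorem theorem3 :
  exists (P : cmd) (C : nat),
    forall (m n : nat) (A : 'M[int]_(m, n)) (b : 'cV[int]_m)
           (D : labelled_graph n) (k : nat),
      (0 < m)%N -> (0 < n)%N ->
      (forall i j, 0 <= A i j) ->
      is_path_decomposition D -> width D A = k ->
      let d := max_entry b in
      exists (s : state) (t : nat),
        [/\ exec P (input A b D) s t,
            answers s (ip_feasible A b)
          & (t <= C * ((d + 1) ^ (k + 1) * m * n + m ^ 2 * n))%N].
Proof.
exists solver, 4000%N => m n A b D k m0 n0 A0 D_path <- d.
by have [s [t [E le_t ans]]] := run_solver b n0 m0 A0 D_path; exists s, t.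
Qed.
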